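(* Let $n>k\ge1$ be coprime integers, $\ell\ge 1$, and $r,s\in\mathbb{Z}$ with $rn=ks+1$. Let $\varepsilon,b,\lambda_1,\dots,\lambda_\ell,\xi_1,\dots,\xi_{k+1}$ be nonzero complex numbers and set $\eta_1=(-1)^{k-1}\varepsilon^r\prod_{i=1}^{k}\xi_i^{-1}$, $\eta_2=(-1)^{k}\varepsilon^r b\prod_{i=1}^{k+1}\xi_i^{-1}$. Assume: $\lambda_1,\dots,\lambda_\ell,\eta_1,\eta_2\ne1$; $\lambda_1,\dots,\lambda_\ell\neq\eta_1$; $\xi_i\ne\xi_j$ for $i\ne j$; $\xi_1,\dots,\xi_{k+1}\ne b$; $\xi_1^k,\dots,\xi_{k+1}^k,b^k\ne\varepsilon^r$; $\sum_{i=1}^k\xi_i\ne0$; $\eta_1\neq\eta_2$; $\lambda_1\cdots\lambda_\ell\,\xi_1^\ell\cdots\xi_k^\ell\,\xi_{k+1}=(-1)^{(k-1)\ell}b\,\varepsilon^{r\ell}$; and $\xi_i^n=\varepsilon^s$ for all $i=1,\dots,k+1$. Then $(\varepsilon;b;\lambda_1,\dots,\lambda_\ell;\xi_1,\dots,\xi_{k+1};\ell,\dots,\ell,1)$ is the numerical local data of an irreducible rigid Pochhammer local system $\mathcal{L}$ on $\mathbb{C}^2\setminus Y^*_{n,k,\ell}$ of multiplicity one along the irreducible components of $Y^*_{n,k,\ell}=\{y\prod_{i=1}^\ell(y^k-C_ix^n)=0\}$. Moreover, $\mathcal{L}|_{\mathbb{C}^2\setminus\widetilde{Y}^*_\bullet}\equiv\mathcal{F}^{\oplus(\ell-1)}|_{\mathbb{C}^2\setminus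 Y^*_\bullet}\oplus\mathcal{G}^*$, where $\mathcal{F}$ is the rigid irreducible Pochhammer local system of multiplicity one on $\mathbb{C}^2\setminus Y_\bullet$ determined by the tuple $(\varepsilon;\eta_1;\xi_1,\dots,\xi_k;1,\dots,1)$ and $\mathcal{G}^*$ is the rigid irreducible Pochhammer local system of multiplicity one on $\mathbb{C}^2\setminus Y^*_\bullet$ determined by the tuple $(\varepsilon;b;\eta_2;\xi_1,\dots,\xi_{k+1};1,\dots,1)$.
   Context: Local systems are locally constant sheaves of finite-dimensional complex vector spaces; $\varrho$ denotes monodromy representation. A pseudo-reflection is an invertible matrix $M$ with $\mathrm{codim}\ker(M-\mathbf{I})=1$; its special eigenvalue is $\det M$, always assumed $\ne1$. Curves. Choose $\rho>0$ and nonzero complex numbers $C,C_1,\dots,C_\ell$, with $C_1,\dots,C_\ell$ distinct, such that the fat curve $\widetilde{Y}_\bullet=\{(t^k,\lambda t^n):|\lambda^k-C|\le\rho,\ t\in\mathbb{C}\}$ (disjoint from $\{y=0\}$ away from the origin) contains the curves $Y_i=\{y^k=C_ix^n\}$, $1\le i\le\ell$. Set $Y_0=\{y=0\}$, $Y_\bullet=\{y^k-Cx^n=0\}$, $Y^*_\bullet=\{y(y^k-Cx^n)=0\}$, $\widetilde{Y}^*_\bullet=\widetilde{Y}_\bullet\cup Y_0$. The inclusion $\mathbb{C}^2\setminus\widetilde{Y}^*_\bullet\subset\mathbb{C}^2\setminus Y^*_\bullet$ is a homotopy equivalence, and $\equiv$ means isomorphism after identifying local systems on these two spaces. Turbines and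 fundamental groups. For closed discs $D_{\rho_1},D_{\rho_2}\subset\mathbb{C}$ centered at $0$, $0<\rho_1\ll\rho_2$ suitable, let $N_\infty=\partial D_{\rho_1}\times D_{\rho_2}$, and let $N_0,\dots,N_\ell\subset\mathrm{int}(N_\infty)$ be disjoint thin closed tubular neighbourhoods of the knots $Y_i\cap\partial(D_{\rho_1}\times D_{\rho_2})$. The turbine of $Y^*_{n,k,\ell}$ is $T^*_{n,k,\ell}=N_\infty\setminus\bigcup_{i=0}^\ell\mathrm{int}(N_i)$ (with shaft); the turbine of $Y_{n,k,\ell}=\bigcup_{i=1}^\ell Y_i$ is $T_{n,k,\ell}=N_\infty\setminus\bigcup_{i=1}^\ell\mathrm{int}(N_i)$ (without shaft). With $\alpha_i,\beta_i$ the standard meridian and parallel of $\partial N_i$, and $\delta=\alpha_i^n\beta_i^k$, $\omega_i=\alpha_i^s\beta_i^r$ for $i=0,\infty$ (so $\alpha_i=\delta^r\omega_i^{-k}$), $\pi_1(T^*_{n,k,\ell})=\langle\alpha_1,\dots,\alpha_\ell,\omega_0,\omega_\infty:\alpha_1\cdots\alpha_\ell\omega_\infty=\omega_0\rangle\times\langle\delta\rangle$ ($\langle\delta\rangle$ infinite cyclic), $\pi_1(T_{n,k,\ell})$ is its quotient by $\omega_0^k=\delta^r$, and $\pi_1(\mathbb{C}^2\setminus Y^*_{n,k,\ell})$ [resp. $\pi_1(\mathbb{C}^2\setminus Y_{n,k,\ell})$] is the quotient of $\pi_1(T^*_{n,k,\ell})$ [resp. $\pi_1(T_{n,k,\ell})$]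 by $\omega_\infty^n=\delta^s$. $\pi_1(\partial N_i)$ is generated by $\omega_i,\delta$ ($i=0,\infty$), resp. $\alpha_i,\delta$ ($1\le i\le\ell$). The curves $Y_\bullet$, $Y_\bullet^*$ are the case $\ell=1$ (with $C_1=C$). Rigidity. A local system on a turbine is rigid if it is determined, up to isomorphism among local systems on that turbine, by its restrictions to the boundary tori ($\partial N_i$, $i\in\{0,\dots,\ell,\infty\}$ with shaft; $i\in\{1,\dots,\ell,\infty\}$ without). A local system on the complement of one of these weighted homogeneous curves is rigid if its restriction to the turbine of the curve is rigid. Pochhammer. A local system on $\mathbb{C}^2\setminus Y^*_{n,k,\ell}$ with fibre $V$ is Pochhammer if, for the free generators $g\in\{\alpha_0\}\cup\{\omega_0^{k-1-j}\alpha_i\omega_0^{1-k+j}:0\le j\le k-1,1\le i\le\ell\}$ of the fundamental group of the complement of the curve in a generic line $x=$ const, one has $\dim V=\sum_g\mathrm{codim}\,V^g$ and $\bigcap_gV^g=0$, where $V^g=\ker(\varrho(g)-1)$; it has multiplicity one if all $\mathrm{codim}\,V^g=1$. For $Y_{n,k,\ell}$ omit $\alpha_0$. Numerical local data. For $Y^*_{n,k,\ell}$: $(\varepsilon;b;\lambda_1,\dots,\lambda_\ell;\xi_1,\dots,\xi_\nu;m_1,\dots,m_\nu)$ means $\varrho(\delta)=\varepsilon\mathbf{I}$; $\varrho(\alpha_i)$ is a pseudo-reflection with special eigenvalue $\lambda_i$ ($1\le i\le\ell$); $\varrho(\omega_0)$ is conjugate to $\zeta_1\mathbf{I}_\ell\oplus\cdots\oplus\zeta_k\mathbf{I}_\ell\oplus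 b$ with $\zeta_1,\dots,\zeta_k$ the $k$-th roots of $\varepsilon^r$; $\varrho(\omega_\infty)$ is conjugate to $\xi_1\mathbf{I}_{m_1}\oplus\cdots\oplus\xi_\nu\mathbf{I}_{m_\nu}$ with distinct $\xi_j$. For $Y_{n,k,\ell}$: $(\varepsilon;\lambda_1,\dots,\lambda_\ell;\xi_1,\dots,\xi_\nu;m_1,\dots,m_\nu)$ has the same meaning with $\varrho(\omega_0)$ conjugate to $\zeta_1\mathbf{I}_\ell\oplus\cdots\oplus\zeta_k\mathbf{I}_\ell$.
   Formalization: The sign of η₂ is corrected to η₂ = (-1)^{k-1} ε^r b ∏ξ_i^{-1}; with the printed (-1)^k no 𝒢* with the stated data exists, since α₁ω_∞ = ω₀ forces η₂∏ξ_i = (-1)^{k-1} ε^r b. *)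

(* Defs.v *)
(* A local system on a connected space is represented by its
   monodromy representation on column vectors, the fundamental group being
   given by generators and relations; restriction to a subspace is pull-back
   along the homomorphism of fundamental groups induced by the inclusion. *)
From HB Require Import structures.
From mathcomp Require Import all_boot all_order all_algebra.
From mathcomp Require Import boolp reals.
From mathcomp Require Import complex.

Set Implicit Arguments.
Unset Strict Implicit.
Unset Printing Implicit Defensive.

Import Order.TTheory GRing.Theory Num.Theory.

Local Open Scope ring_scope.
Local Open Scope quotient_scope.

(** * Groups given by generators and relations *)

Inductive word (X : Type) : Type :=
| WGen of X
| WOne
| WMul of word X & word X
| WInv of word X.
Arguments WOne {X}.

HB.instance Definition _ (X : Type) := gen_eqMixin (word X).
HB.instance Definition _ (X : Type) := gen_choiceMixin (word X).

Definition wexpn (X : Type) (w : word X) (n : nat) : word X :=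
  iter n (WMul w) WOne.

Definition wexpz (X : Type) (w : word X) (m : int) : word X :=
  match m with
  | Posz n => wexpn w n
  | Negz n => WInv (wexpn w n.+1)
  end.

Definition wprod (X : Type) (s : seq (word X)) : word X :=
  foldr (@WMul X) WOne s.

Fixpoint weval (X : Type) (H : groupType) (f : X -> H) (w : word X) : H :=
  match w with
  | WGen x => f x
  | WOne => 1%g
  | WMul u v => (weval f u * weval f v)%g
  | WInv u => (weval f u)^-1%g
  end.

(* A pair (u, v) with [R u v] stands for the relation u = v. *)
Definition wrel (X : Type) := word X -> word X -> Prop.

Definition adjoin_rel (X : Type) (R : wrel X) (u v : word X) : wrel X :=
  fun a b => R a b \/ (a = u /\ b = v).

Section Presented.
Variables (X : Type) (R : wrel X).

Inductive wcong : word X -> word X -> Prop :=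
| wcong_rel u v : R u v -> wcong u v
| wcong_refl u : wcong u u
| wcong_sym u v : wcong u v -> wcong v u
| wcong_trans u v w : wcong u v -> wcong v w -> wcong u w
| wcong_mul u u' v v' : wcong u u' -> wcong v v' ->
    wcong (WMul u v) (WMul u' v')
| wcong_inv u u' : wcong u u' -> wcong (WInv u) (WInv u')
| wcong_mulA u v w : wcong (WMul u (WMul v w)) (WMul (WMul u v) w)
| wcong_mul1l u : wcong (WMul WOne u) u
| wcong_mul1r u : wcong (WMul u WOne) u
| wcong_mulVl u : wcong (WMul (WInv u) u) WOne
| wcong_mulVr u : wcong (WMul u (WInv u)) WOne.

Definition wcongb (u v : word X) : bool := `[< wcong u v >].

Lemma wcongb_refl : reflexive wcongb.
Proof. by move=> u; apply/asboolP; apply: wcong_refl. Qed.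

Lemma wcongb_sym : symmetric wcongb.
Proof.
by move=> u v; apply/idP/idP => /asboolP h; apply/asboolP; apply: wcong_sym.
Qed.

Lemma wcongb_trans : transitive wcongb.
Proof.
by move=> v u w /asboolP h1 /asboolP h2; apply/asboolP; apply: wcong_trans h2.
Qed.

Canonical wcong_equiv := EquivRel wcongb wcongb_refl wcongb_sym wcongb_trans.

Definition presented : Type := {eq_quot wcongb}.
HB.instance Definition _ := Choice.on presented.
HB.instance Definition _ := EqQuotient.on presented.

Definition pres_pi (w : word X) : presented := \pi_presented w.
Definition pres_one : presented := pres_pi WOne.
Definition pres_mul (x y : presented) : presented :=
  pres_pi (WMul (repr x) (repr y)).
Definition pres_inv (x : presented) : presented := pres_pi (WInv (repr x)).

Lemma pres_piP (u v : word X) : pres_pi u = pres_pi v <-> wcong u v.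
Proof.
split; first by move/eqmodP => /asboolP.
by move=> h; apply/eqmodP/asboolP.
Qed.

Lemma wcong_repr (u : word X) : wcong (repr (pres_pi u)) u.
Proof. by apply/pres_piP; rewrite /pres_pi reprK. Qed.

Lemma pres_piE (x : presented) : x = pres_pi (repr x).
Proof. by rewrite /pres_pi reprK. Qed.

Lemma pres_piM (u v : word X) :
  pres_mul (pres_pi u) (pres_pi v) = pres_pi (WMul u v).
Proof. by apply/pres_piP; apply: wcong_mul; apply: wcong_repr. Qed.

Lemma pres_piV (u : word X) : pres_inv (pres_pi u) = pres_pi (WInv u).
Proof. by apply/pres_piP; apply: wcong_inv; apply: wcong_repr. Qed.

Lemma pres_mulA : associative pres_mul.
Proof.
move=> x y z; rewrite (pres_piE x) (pres_piE y) (pres_piE z) !pres_piM.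
by apply/pres_piP; apply: wcong_mulA.
Qed.

Lemma pres_mul1 : left_id pres_one pres_mul.
Proof.
by move=> x; rewrite (pres_piE x) pres_piM; apply/pres_piP; apply: wcong_mul1l.
Qed.

Lemma pres_1mul : right_id pres_one pres_mul.
Proof.
by move=> x; rewrite (pres_piE x) pres_piM; apply/pres_piP; apply: wcong_mul1r.
Qed.

Lemma pres_mulV : left_inverse pres_one pres_inv pres_mul.
Proof.
move=> x; rewrite (pres_piE x) pres_piV pres_piM.
by apply/pres_piP; apply: wcong_mulVl.
Qed.

Lemma pres_Vmul : right_inverse pres_one pres_inv pres_mul.
Proof.
move=> x; rewrite (pres_piE x) pres_piV pres_piM.
by apply/pres_piP; apply: wcong_mulVr.
Qed.

HB.instance Definition _ := isGroup.Build presented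
  pres_mulA pres_mul1 pres_1mul pres_mulV pres_Vmul.

Definition pres_gen (x : X) : presented := pres_pi (WGen x).

Lemma weval_pres_gen (w : word X) : weval pres_gen w = pres_pi w.
Proof.
elim: w => //= [u -> v -> | u ->]; [exact: pres_piM | exact: pres_piV].
Qed.

Lemma pres_gen_rel (u v : word X) :
  R u v -> weval pres_gen u = weval pres_gen v.
Proof.
by move=> h; rewrite !weval_pres_gen; apply/pres_piP; apply: wcong_rel.
Qed.

Section Lift.
Variables (H : groupType) (f : X -> H).
Hypothesis f_rel : forall u v, R u v -> weval f u = weval f v.

Lemma weval_wcong (u v : word X) : wcong u v -> weval f u = weval f v.
Proof.
elim=> //= {u v}.
- by move=> u v w _ -> _ ->.
- by move=> u u' v v' _ -> _ ->.
- by move=> u u' _ ->.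
- by move=> u v w; rewrite mulgA.
- by move=> u; rewrite mul1g.
- by move=> u; rewrite mulg1.
- by move=> u; rewrite mulVg.
- by move=> u; rewrite mulgV.
Qed.

Definition lift_fun (x : presented) : H := weval f (repr x).

Lemma lift_funM : {morph lift_fun : x y / (x * y)%g}.
Proof. by move=> x y; rewrite /lift_fun (weval_wcong (wcong_repr _)). Qed.

Lemma lift_fun1 : lift_fun 1%g = 1%g.
Proof. by rewrite /lift_fun (weval_wcong (wcong_repr _)). Qed.

Lemma lift_fun_gen (x : X) : lift_fun (pres_gen x) = f x.
Proof. by rewrite /lift_fun (weval_wcong (wcong_repr _)). Qed.

End Lift.
End Presented.

Definition ghom (G H : groupType) := UMagmaMorphism.type G H.

Definition pres_lift (X : Type) (R : wrel X) (H : groupType) (f : X -> H)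
    (f_rel : forall u v, R u v -> weval f u = weval f v) :
    ghom (presented R) H :=
  HB.pack (lift_fun f : presented R -> H)
    (isUMagmaMorphism.Build _ _ (lift_fun f : presented R -> H)
       (lift_fun1 f_rel, lift_funM f_rel)).

Definition pres_quot (X : Type) (R R' : wrel X)
    (sRR' : forall u v, R u v -> R' u v) :
    ghom (presented R) (presented R') :=
  pres_lift (fun u v h => pres_gen_rel (sRR' u v h)).

Definition expgz (G : groupType) (x : G) (m : int) : G :=
  match m with
  | Posz n => (x ^+ n)%g
  | Negz n => (x ^- n.+1)%g
  end.

(** * Fundamental groups of the turbines and of the curve complements *)

Inductive tgen (l : nat) : Type :=
| Alpha of 'I_l
| Omega0
| OmegaInf
| Delta.
Arguments Omega0 {l}.
Arguments OmegaInf {l}.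
Arguments Delta {l}.

Definition alpha_word (l : nat) : word (tgen l) :=
  wprod [seq WGen (Alpha i) | i <- enum 'I_l].

Inductive turbine_star_rel (l : nat) : wrel (tgen l) :=
| TS_omega :
    turbine_star_rel (WMul (alpha_word l) (WGen OmegaInf)) (WGen Omega0)
| TS_delta (x : tgen l) :
    turbine_star_rel (WMul (WGen Delta) (WGen x)) (WMul (WGen x) (WGen Delta)).

Definition turbine_rel (k l : nat) (r : int) : wrel (tgen l) :=
  adjoin_rel (@turbine_star_rel l)
    (wexpn (WGen Omega0) k) (wexpz (WGen Delta) r).

Definition compl_star_rel (n l : nat) (s : int) : wrel (tgen l) :=
  adjoin_rel (@turbine_star_rel l)
    (wexpn (WGen OmegaInf) n) (wexpz (WGen Delta) s).

Definition compl_rel (n k l : nat) (r s : int) : wrel (tgen l) :=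
  adjoin_rel (@turbine_rel k l r)
    (wexpn (WGen OmegaInf) n) (wexpz (WGen Delta) s).

(* The groups depend on the curves only through n, k, l and on r, s, and not
   on the constants C, C_1, ..., C_l; that of T*_{n,k,l} depends only on l.
   In order: pi_1 of T*_{n,k,l}, of T_{n,k,l}, of C^2 \ Y*_{n,k,l}, of C^2 \ Y_{n,k,l} *)
Definition pi1_turbine_star (l : nat) : groupType :=
  presented (@turbine_star_rel l).
Definition pi1_turbine (k l : nat) (r : int) : groupType :=
  presented (@turbine_rel k l r).
Definition pi1_compl_star (n l : nat) (s : int) : groupType :=
  presented (@compl_star_rel n l s).
Definition pi1_compl (n k l : nat) (r s : int) : groupType :=
  presented (@compl_rel n k l r s).

Section Generators.
Variables (l : nat) (R : wrel (tgen l)).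
Definition galpha (i : 'I_l) : presented R := pres_gen R (Alpha i).
Definition gomega0 : presented R := pres_gen R Omega0.
Definition gomegaInf : presented R := pres_gen R OmegaInf.
Definition gdelta : presented R := pres_gen R Delta.

(* The meridian alpha_0 = delta^r omega_0^{-k} of the shaft {y = 0}. *)
Definition galpha0 (k : nat) (r : int) : presented R :=
  (expgz gdelta r * gomega0 ^- k)%g.

(* The free generators of pi_1 of the complement of Y_{n,k,l} in a generic
   line x = const, and of the complement of Y*_{n,k,l} in that line. *)
Definition line_gens (k : nat) : seq (presented R) :=
  [seq (gomega0 ^+ (k.-1 - j) * galpha i * gomega0 ^- (k.-1 - j))%g
     | j <- iota 0 k, i <- enum 'I_l].
Definition line_star_gens (k : nat) (r : int) : seq (presented R) :=
  galpha0 k r :: line_gens k.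
End Generators.

(** Homomorphisms induced by inclusions *)

Definition turbine_star_incl (n l : nat) (s : int) :
    ghom (pi1_turbine_star l) (pi1_compl_star n l s) :=
  @pres_quot _ (@turbine_star_rel l) (@compl_star_rel n l s)
    (fun u v h => or_introl h).

Definition turbine_incl (n k l : nat) (r s : int) :
    ghom (pi1_turbine k l r) (pi1_compl n k l r s) :=
  @pres_quot _ (@turbine_rel k l r) (@compl_rel n k l r s)
    (fun u v h => or_introl h).

Lemma compl_star_sub (n k l : nat) (r s : int) (u v : word (tgen l)) :
  compl_star_rel n s u v -> compl_rel n k r s u v.
Proof. by case=> h; [left; left | right]. Qed.

(* Induced by the inclusion of C^2 \ Y*_{n,k,l} into C^2 \ Y_{n,k,l}. *)
Definition fill_shaft (n k l : nat) (r s : int) :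
    ghom (pi1_compl_star n l s) (pi1_compl n k l r s) :=
  pres_quot (@compl_star_sub n k l r s).

(* Induced by the inclusion of C^2 \ ~Y*_. into C^2 \ Y*_{n,k,l}, the former
   being identified with C^2 \ Y*_. (the case l = 1) up to homotopy: the
   meridian of the fat curve ~Y_. goes to alpha_1 ... alpha_l, and omega_0,
   omega_oo, delta go to the elements of the same name. *)
Definition fat_gen (n l : nat) (s : int) (x : tgen 1) : pi1_compl_star n l s :=
  match x with
  | Alpha _ => (\prod_(i < l) galpha (compl_star_rel n s) i)%g
  | Omega0 => gomega0 _
  | OmegaInf => gomegaInf _
  | Delta => gdelta _
  end.

Lemma weval_expn (X : Type) (H : groupType) (f : X -> H) (w : word X) n :
  weval f (wexpn w n) = (weval f w ^+ n)%g.
Proof. by elim: n => [|n IHn] //=; rewrite IHn expgS. Qed.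

Lemma weval_expz (X : Type) (H : groupType) (f : X -> H) (w : word X) m :
  weval f (wexpz w m) = expgz (weval f w) m.
Proof. by case: m => n; rewrite /= -?weval_expn. Qed.

Lemma weval_alpha_word (l : nat) (H : groupType) (f : tgen l -> H) :
  weval f (alpha_word l) = (\prod_(i < l) f (Alpha i))%g.
Proof.
rewrite /alpha_word [index_enum _]unlock -enumT.
by elim: (enum _) => [|i s IHs]; rewrite ?big_nil // big_cons -IHs.
Qed.

Lemma fat_gen_rel (n l : nat) (s : int) (u v : word (tgen 1)) :
  compl_star_rel n s u v -> weval (@fat_gen n l s) u = weval (@fat_gen n l s) v.
Proof.
have E x y : compl_star_rel n s x y ->
    weval (pres_gen (@compl_star_rel n l s)) x
      = weval (pres_gen (@compl_star_rel n l s)) y by exact: pres_gen_rel.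
case=> [[|x]|[-> ->]].
- have := E _ _ (or_introl (TS_omega l)).
  by rewrite /= !weval_alpha_word big_ord1.
- have cd y := E _ _ (or_introl (TS_delta y)).
  case: x => [i||| ] /=; [|exact: cd..].
  apply: (big_ind (fun z => (gdelta _ * z = z * gdelta _)%g)).
  + by rewrite mulg1 mul1g.
  + by move=> a b ha hb; rewrite mulgA ha -mulgA hb mulgA.
  + by move=> j _; exact: cd (Alpha j).
- have := E _ _ (or_intror (conj erefl erefl)).
  by rewrite !weval_expn !weval_expz.
Qed.

Definition fat_incl (n l : nat) (s : int) :
    ghom (pi1_compl_star n 1 s) (pi1_compl_star n l s) :=
  pres_lift (@fat_gen_rel n l s).

(** Boundary tori: pi_1 is free abelian on a transverse generator and delta *)

Inductive torus_gen := TTrans | TDelta.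

Inductive torus_rel : wrel torus_gen :=
| Torus_comm : torus_rel (WMul (WGen TDelta) (WGen TTrans))
                         (WMul (WGen TTrans) (WGen TDelta)).

Definition pi1_torus : groupType := presented torus_rel.

Definition torus_map (l : nat) (R : wrel (tgen l)) (x : tgen l)
    (y : torus_gen) : presented R :=
  match y with TTrans => pres_gen R x | TDelta => gdelta R end.

Lemma torus_map_rel (l : nat) (R : wrel (tgen l)) (x : tgen l)
    (sR : forall u v, turbine_star_rel u v -> R u v) (u v : word torus_gen) :
  torus_rel u v -> weval (torus_map R x) u = weval (torus_map R x) v.
Proof. by case=> /=; exact: (pres_gen_rel (sR _ _ (TS_delta x))). Qed.

Inductive boundary_star (l : nat) : Type := SB0 | SB of 'I_l | SBinf.
Inductive boundary (l : nat) : Type := NB of 'I_l | NBinf.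

Definition boundary_star_incl (l : nat) (i : boundary_star l) :
    ghom pi1_torus (pi1_turbine_star l) :=
  pres_lift (@torus_map_rel l (@turbine_star_rel l)
    (match i with SB0 => Omega0 | SB i => Alpha i | SBinf => OmegaInf end)
    (fun u v h => h)).

Definition boundary_incl (k l : nat) (r : int) (i : boundary l) :
    ghom pi1_torus (pi1_turbine k l r) :=
  pres_lift (@torus_map_rel l (@turbine_rel k l r)
    (match i with NB i => Alpha i | NBinf => OmegaInf end)
    (fun u v h => or_introl h)).

Definition front (T : Type) (k : nat) (x : 'I_k.+1 -> T) : 'I_k -> T :=
  fun i => x (widen_ord (leqnSn k) i).

(** * Matrices *)

Section Matrices.
Variable F : fieldType.

(* Conjugacy; the sizes are not assumed equal, but P and Q force d = m. *)
Definition conjugate_mx (d m : nat) (M : 'M[F]_d) (N : 'M[F]_m) : Prop :=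
  exists (P : 'M[F]_(d, m)) (Q : 'M[F]_(m, d)),
    [/\ P *m Q = 1%:M, Q *m P = 1%:M & M = P *m N *m Q].

(* The kernel of M - 1, as a space of column vectors. *)
Definition fixed_space (d : nat) (M : 'M[F]_d) : {vspace 'cV[F]_d} :=
  lker (linfun (mulmx (M - 1%:M) : 'cV[F]_d -> 'cV[F]_d)).

Definition fixed_codim (d : nat) (M : 'M[F]_d) : nat :=
  (d - \dim (fixed_space M))%N.

Definition pseudo_reflection (d : nat) (M : 'M[F]_d) (lambda : F) : Prop :=
  [/\ M \in unitmx, fixed_codim M = 1%N, \det M = lambda & lambda <> 1].

(* x_1 I_{m_1} (+) ... (+) x_p I_{m_p} for s = [:: (x_1, m_1); ...; (x_p, m_p)] *)
Definition block_diag (s : seq (F * nat)) :=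
  let e := flatten [seq nseq x.2 x.1 | x <- s] in
  diag_mx (\row_(i < size e) e`_i).

End Matrices.

(** * Local systems *)

Record local_system (F : fieldType) (G : groupType) := LocalSystem {
  ls_rank : nat;
  ls_rho :> G -> 'M[F]_ls_rank;
  ls_rho1 : ls_rho 1%g = 1%:M;
  ls_rhoM : forall g h : G, ls_rho (g * h)%g = ls_rho g *m ls_rho h
}.

Section LocalSystems.
Variable F : fieldType.

Definition ls_iso (G : groupType) (L M : local_system F G) : Prop :=
  exists (P : 'M[F]_(ls_rank L, ls_rank M)) (Q : 'M[F]_(ls_rank M, ls_rank L)),
    [/\ P *m Q = 1%:M, Q *m P = 1%:M & forall g, L g = P *m M g *m Q].

Definition unique_up_to_iso (G : groupType) (P : local_system F G -> Prop)
    (L : local_system F G) : Prop :=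
  P L /\ forall L' : local_system F G, P L' -> ls_iso L' L.

Section Restrict.
Variables (G H : groupType) (phi : ghom G H) (L : local_system F H).

Lemma restrict1 : L (phi 1%g) = 1%:M.
Proof. by rewrite gmulf1 ls_rho1. Qed.

Lemma restrictM (g h : G) : L (phi (g * h)%g) = L (phi g) *m L (phi h).
Proof. by rewrite gmulfM ls_rhoM. Qed.

Definition ls_restrict : local_system F G := LocalSystem restrict1 restrictM.
End Restrict.

Section DirectSum.
Variables (G : groupType) (L M : local_system F G).

Definition dsum_rho (g : G) : 'M[F]_(ls_rank L + ls_rank M) :=
  block_mx (L g) 0 0 (M g).

Lemma dsum_rho1 : dsum_rho 1%g = 1%:M.
Proof. by rewrite /dsum_rho !ls_rho1 -scalar_mx_block. Qed.

Lemma dsum_rhoM (g h : G) : dsum_rho (g * h)%g = dsum_rho g *m dsum_rho h.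
Proof.
by rewrite /dsum_rho !ls_rhoM mulmx_block !mulmx0 !mul0mx !addr0 !add0r.
Qed.

Definition dsum : local_system F G := LocalSystem dsum_rho1 dsum_rhoM.
End DirectSum.

Section ZeroSystem.
Variable G : groupType.

Lemma zero_rhoM (g h : G) : (0 : 'M[F]_0) = 0 *m (0 : 'M[F]_0).
Proof. by rewrite mulmx0. Qed.

Definition zero_ls : local_system F G :=
  @LocalSystem F G 0 (fun=> 0) (esym (thinmx0 _)) zero_rhoM.
End ZeroSystem.

Definition dsum_pow (G : groupType) (L : local_system F G) (m : nat) :
  local_system F G := iter m (dsum L) (zero_ls G).

Definition ls_irreducible (G : groupType) (L : local_system F G) : Prop :=
  (0 < ls_rank L)%N /\
  forall U : {vspace 'cV[F]_(ls_rank L)},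
    (forall g u, u \in U -> L g *m u \in U) -> U = 0%VS \/ U = fullv.

(* [gs] is the list of the free generators of pi_1 of the complement of the
   curve in a generic line x = const. *)
Definition pochhammer (G : groupType) (gs : seq G) (L : local_system F G) :=
  ls_rank L = (\sum_(g <- gs) fixed_codim (L g))%N /\
  (\bigcap_(g <- gs) fixed_space (L g) = 0)%VS.

Definition multiplicity_one (G : groupType) (gs : seq G)
    (L : local_system F G) :=
  forall g, g \in gs -> fixed_codim (L g) = 1%N.

(** Rigidity *)

(* The competitors L' have arbitrary rank. *)

Definition determined_by_boundary (G : groupType) (I : Type)
    (b : I -> ghom pi1_torus G) (L : local_system F G) : Prop :=
  forall L' : local_system F G,
    (forall i, ls_iso (ls_restrict (b i) L') (ls_restrict (b i) L)) -> ls_iso L' L.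

Definition ls_rigid_star (n l : nat) (s : int)
    (L : local_system F (pi1_compl_star n l s)) : Prop :=
  determined_by_boundary (@boundary_star_incl l)
    (ls_restrict (turbine_star_incl n l s) L).

Definition ls_rigid (n k l : nat) (r s : int)
    (L : local_system F (pi1_compl n k l r s)) : Prop :=
  determined_by_boundary (@boundary_incl k l r)
    (ls_restrict (turbine_incl n k l r s) L).

(** [rip1]: rigid, irreducible, Pochhammer, of multiplicity one *)

Definition rip1_star (n k l : nat) (r s : int)
    (L : local_system F (pi1_compl_star n l s)) : Prop :=
  let gs := line_star_gens (@compl_star_rel n l s) k r in
  [/\ ls_irreducible L, ls_rigid_star L, pochhammer gs L & multiplicity_one gs L].

Definition rip1 (n k l : nat) (r s : int)
    (L : local_system F (pi1_compl n k l r s)) : Prop :=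
  let gs := line_gens (@compl_rel n k l r s) k in
  [/\ ls_irreducible L, ls_rigid L, pochhammer gs L & multiplicity_one gs L].

(** Numerical local data *)

(* [zs] lists the k-th roots of c without repetition. *)

Definition roots_of (k : nat) (c : F) (zs : seq F) : Prop :=
  uniq zs /\ forall z, (z \in zs) = (z ^+ k == c).

Record local_data_star (n k l : nat) (r s : int) (eps b : F)
    (lambda : 'I_l -> F) (nu : nat) (xi : 'I_nu -> F) (m : 'I_nu -> nat)
    (L : local_system F (pi1_compl_star n l s)) : Prop := {
  lds_xi : injective xi;
  lds_delta : L (gdelta _) = eps%:M;
  lds_alpha : forall i, pseudo_reflection (L (galpha _ i)) (lambda i);
  lds_omega0 : exists2 zs, roots_of k (eps ^ r) zs &
    conjugate_mx (L (gomega0 _))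
      (block_diag (rcons [seq (z, l) | z <- zs] (b, 1%N)));
  lds_omegaInf :
    conjugate_mx (L (gomegaInf _))
      (block_diag [seq (xi j, m j) | j <- enum 'I_nu])
}.

Record local_data (n k l : nat) (r s : int) (eps : F)
    (lambda : 'I_l -> F) (nu : nat) (xi : 'I_nu -> F) (m : 'I_nu -> nat)
    (L : local_system F (pi1_compl n k l r s)) : Prop := {
  ld_xi : injective xi;
  ld_delta : L (gdelta _) = eps%:M;
  ld_alpha : forall i, pseudo_reflection (L (galpha _ i)) (lambda i);
  ld_omega0 : exists2 zs, roots_of k (eps ^ r) zs &
    conjugate_mx (L (gomega0 _)) (block_diag [seq (z, l) | z <- zs]);
  ld_omegaInf :
    conjugate_mx (L (gomegaInf _))
      (block_diag [seq (xi j, m j) | j <- enum 'I_nu])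
}.

End LocalSystems.

(* Main.v *)
(* Write [A] for the product of the [rho(alpha_i)]; then [rho(omega_0) = A rho(omega_oo)].

   F and G are hypergeometric: they are given by companion matrices of the
   polynomials with roots the eigenvalues of [omega_0] and [omega_oo], which
   differ by a rank one matrix.  On F^(l-1) + G the meridian of the fat curve
   acts by [1 + X Y] with [Y X] of size [l] and [1 + Y X] similar to
   [diag(eta2, eta1, ..., eta1)].  Since [prod lambda_i = eta2 eta1^(l-1)],
   this matrix is the product of the [l] pseudo-reflections with special
   eigenvalues [lambda_i] of a Jordan-Pochhammer system, and transporting the
   factorization along [X] and [Y] gives the [rho(alpha_i)] of L.

   Irreducibility: an invariant subspace either contains the images of all the
   [rho(alpha_i) - 1] or is fixed by all the [rho(alpha_i)]; accordingly
   [omega_0] and [omega_oo] agree on the quotient or on the subspace, where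
   they have no common eigenvalue.

   Rigidity is Katz's argument: if L' has the same local data as L, Scott's
   lemma applied to Hom(L, L'), where the codimensions of the fixed spaces of
   the local monodromies add up to [2 (d^2 - 1) < 2 d^2], produces a nonzero
   morphism between L and L', hence an isomorphism by Schur's lemma. *)
Require Import Defs.
From HB Require Import structures.
From mathcomp Require Import all_boot all_order all_algebra.
From mathcomp Require Import boolp reals.
From mathcomp Require Import complex ring zify separable.

Set Implicit Arguments.
Unset Strict Implicit.
Unset Printing Implicit Defensive.

Import Order.TTheory GRing.Theory Num.Theory.

Local Open Scope ring_scope.

(** * Conjugacy, with spectra as lists *)

Section Conjugacy.
Variable F : fieldType.
Implicit Types (e f : seq F).

(** Spectra are lists with repetition, so that direct sums become concatenations. Up to conversion,
    [block_diag] is [dseq] of the flattened list. *)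
Definition dseq e : 'M[F]_(size e) := diag_mx (\row_(i < size e) e`_i).

Lemma dseqE e i j : dseq e i j = e`_i *+ (i == j).
Proof. by rewrite !mxE. Qed.

Lemma conj_refl d (M : 'M[F]_d) : conjugate_mx M M.
Proof. by exists 1%:M, 1%:M; rewrite !mulmx1 mul1mx. Qed.

Lemma conj_sym d m (M : 'M[F]_d) (N : 'M[F]_m) :
  conjugate_mx M N -> conjugate_mx N M.
Proof.
move=> [P [Q [PQ QP ->]]]; exists Q, P; split=> //.
by rewrite !mulmxA QP mul1mx -mulmxA QP mulmx1.
Qed.

Lemma conj_trans d m p (M : 'M[F]_d) (N : 'M[F]_m) (O : 'M[F]_p) :
  conjugate_mx M N -> conjugate_mx N O -> conjugate_mx M O.
Proof.
move=> [P [Q [PQ QP ->]]] [P' [Q' [PQ' QP' ->]]].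
exists (P *m P'), (Q' *m Q); split; rewrite ?mulmxA //.
- by rewrite -(mulmxA P) PQ' mulmx1.
- by rewrite -(mulmxA Q') QP mulmx1.
Qed.

Lemma conj_size d m (M : 'M[F]_d) (N : 'M[F]_m) : conjugate_mx M N -> d = m.
Proof.
move=> [P [Q [/mulmx1_min le1 /mulmx1_min le2 _]]].
by apply/eqP; rewrite eqn_leq le1.
Qed.

(** The sizes are equal only propositionally, so entries are matched through the values of their
    indices. *)
Lemma conj_eq d m (M : 'M[F]_d) (N : 'M[F]_m) : d = m ->
  (forall (i j : 'I_d) (i' j' : 'I_m), i = i' :> nat -> j = j' :> nat ->
    M i j = N i' j') ->
  conjugate_mx M N.
Proof.
move=> e; case: _ / e N => N MN; have -> : M = N by apply/matrixP=> i j; apply: MN.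
exact: conj_refl.
Qed.

Lemma conj_block d m d' m' (M : 'M[F]_d) (N : 'M[F]_m) (M' : 'M[F]_d')
    (N' : 'M[F]_m') :
  conjugate_mx M N -> conjugate_mx M' N' ->
  conjugate_mx (block_mx M 0 0 M') (block_mx N 0 0 N').
Proof.
move=> [P [Q [PQ QP ->]]] [P' [Q' [PQ' QP' ->]]].
exists (block_mx P 0 0 P'), (block_mx Q 0 0 Q').
by split; rewrite !mulmx_block ?(mulmx0, mul0mx, addr0, add0r) ?PQ ?QP ?PQ' ?QP'
  -?scalar_mx_block.
Qed.

Lemma conj_cat e f : conjugate_mx (dseq (e ++ f)) (block_mx (dseq e) 0 0 (dseq f)).
Proof.
apply: conj_eq => [|i j i' j' ii' jj']; first exact: size_cat.
rewrite dseqE -(inj_eq val_inj) /= ii' jj' nth_cat.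
case: (split_ordP i') => i0 ->; case: (split_ordP j') => j0 ->;
  rewrite ?block_mxEul ?block_mxEur ?block_mxEdl ?block_mxEdr ?dseqE ?mxE /=.
- by [].
- by rewrite (ltn_eqF (leq_trans (ltn_ord i0) (leq_addr _ _))).
- by rewrite gtn_eqF // (leq_trans (ltn_ord j0) (leq_addr _ _)).
- by rewrite addKn eqn_add2l.
Qed.

(** The conjugating matrices are the permutation matrix of the index bijection [g] and its
    transpose. *)
Lemma conj_perm e f : perm_eq e f -> conjugate_mx (dseq e) (dseq f).
Proof.
move=> ef; have sz := perm_size ef.
have /(perm_iotaP 0)[s ps es] := ef.
have us : uniq s by rewrite (perm_uniq ps) iota_uniq.
have ss : size s = size e by rewrite (perm_size ps) size_iota.
have sl (i : 'I_(size e)) : (nth 0 s i < size f)%N.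
  have : nth 0 s i \in s by rewrite mem_nth // ss.
  by rewrite (perm_mem ps) mem_iota.
pose g i := Ordinal (sl i).
have gi : injective g.
  move=> i j /(congr1 val) /= /eqP; rewrite nth_uniq ?ss // => /eqP.
  exact: val_inj.
have eg (i : 'I_(size e)) : e`_i = f`_(g i).
  by rewrite {1}es (nth_map 0%N) ?ss.
have gs (j : 'I_(size f)) : exists i, j = g i.
  have jg : j \in codom g by apply: inj_card_onto; rewrite ?card_ord ?sz.
  by exists (iinv jg); rewrite f_iinv.
exists (\matrix_(i, j) (g i == j)%:R), (\matrix_(j, i) (g i == j)%:R); split.
- apply/matrixP=> i i'; rewrite !mxE (bigD1 (g i)) //= !mxE eqxx mul1r.
  rewrite (inj_eq gi) eq_sym big1 ?addr0 // => j nj.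
  by rewrite !mxE eq_sym (negPf nj) mul0r.
- apply/matrixP=> j j'; rewrite !mxE; have [i ->] := gs j.
  rewrite (bigD1 i) //= !mxE eqxx mul1r.
  rewrite big1 ?addr0 // => j0 nj.
  by rewrite !mxE (inj_eq gi) (negPf nj) mul0r.
- apply/matrixP=> i i'; rewrite dseqE !mxE (bigD1 (g i')) //= !mxE eqxx mulr1.
  rewrite [X in _ + X]big1 ?addr0; last first.
    by move=> j nj; rewrite !mxE [g i' == j]eq_sym (negPf nj) mulr0.
  rewrite (bigD1 (g i)) //= dseqE !mxE eqxx mul1r (inj_eq gi) -eg big1 ?addr0 //.
  by move=> j nj; rewrite !mxE eq_sym (negPf nj) mul0r.
Qed.

Lemma det_conj d (M : 'M[F]_d) e : conjugate_mx M (dseq e) -> \det M = \prod_(x <- e) x.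
Proof.
move=> cM; have ed := conj_size cM; subst d.
have [P [Q [PQ QP ->]]] := cM.
rewrite !det_mulmx mulrAC -det_mulmx PQ det1 mul1r det_diag.
by rewrite (big_nth 0) big_mkord; apply: eq_bigr => i _; rewrite mxE.
Qed.

Lemma unit_conj d (M : 'M[F]_d) e : conjugate_mx M (dseq e) -> 0 \notin e ->
  M \in unitmx.
Proof.
move=> /det_conj dM e0; rewrite unitmxE unitfE dM prodf_seq_neq0.
by apply/allP=> x xe; apply: contraNneq e0 => <-.
Qed.

Lemma conj_exp d (M : 'M[F]_d) e n : conjugate_mx M (dseq e) ->
  conjugate_mx (M ^+ n) (dseq [seq x ^+ n | x <- e]).
Proof.
move=> [P [Q [PQ QP eM]]].
have -> : M ^+ n = P *m (dseq e ^+ n) *m Q.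
  elim: n => [|n IH]; first by rewrite !expr0 mulmx1.
  by rewrite !exprS IH -!mulmxE eM !mulmxA -(mulmxA (P *m _) Q) QP mulmx1.
have c1 : conjugate_mx (P *m (dseq e ^+ n) *m Q) (dseq e ^+ n) by exists P, Q.
apply: conj_trans c1 _; apply: conj_eq; first by rewrite size_map.
have -> : dseq e ^+ n = diag_mx (\row_(i < size e) e`_i ^+ n).
  elim: n => [|n IH].
    by rewrite expr0; apply/matrixP=> i j; rewrite !mxE expr0.
  rewrite exprS IH -mulmxE mulmx_diag; congr diag_mx.
  by apply/rowP=> i; rewrite !mxE exprS.
move=> i j i' j' ii jj; rewrite dseqE !mxE -2!(inj_eq val_inj) /= ii jj.
by rewrite (nth_map 0) // -ii.
Qed.

Lemma conj_scalar d (M : 'M[F]_d) e c : conjugate_mx M (dseq e) ->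
  (forall x, x \in e -> x = c) -> M = c%:M.
Proof.
move=> [P [Q [PQ QP ->]]] ec.
have -> : dseq e = c%:M.
  by apply/matrixP=> i j; rewrite dseqE mxE (ec e`_i) // mem_nth.
by rewrite mul_mx_scalar -scalemxAl PQ scalemx1.
Qed.
End Conjugacy.

(** * Diagonalizability and rank one perturbations of the identity *)

Section RankOne.
Variable F : numFieldType.
Implicit Types (e f : seq F).

(** The minimal polynomial divides a product of distinct linear factors, so [M] is diagonalizable;
    evaluating that product on the diagonal form puts every eigenvalue in [rs]. *)
Lemma conj_annihilated d (M : 'M[F]_d) rs : uniq rs ->
  \prod_(x <- rs) (M - x%:M) = 0 ->
  exists2 e, {subset e <= rs} & conjugate_mx M (dseq e).
Proof.
case: d M => [|d] M urs M0.
  exists [::] => //; exists 0, 0; split; apply/matrixP=> [] [] // [].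
have hM : horner_mx M (\prod_(x <- rs) ('X - x%:P)) = 0.
  rewrite rmorph_prod /= -[RHS]M0; apply: eq_bigr => x _.
  by rewrite rmorphB /= horner_mx_X horner_mx_C.
have [P uP] : diagonalizable M.
  by apply/diagonalizableP; exists rs => //; apply: mxminpoly_min.
move=> /diagonalizable_forPex[D /(simmxP uP) PM].
exists [seq D 0 i | i <- enum 'I_d.+1].
  move=> x /mapP[i _ ->]; have : horner_mx (diag_mx D) (\prod_(x <- rs) ('X - x%:P)) = 0.
    have -> : diag_mx D = P *m M *m invmx P by rewrite PM mulmxK.
    by rewrite (horner_mx_uconj _ M uP) hM mulmx0 mul0mx.
  rewrite horner_mx_diag => /matrixP /(_ i i); rewrite !mxE eqxx mulr1n => /eqP.
  by rewrite -/(root _ _) root_prod_XsubC.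
have cM : conjugate_mx M (diag_mx D).
  exists (invmx P), P; rewrite mulmxV // mulVmx //; split=> //.
  by rewrite -mulmxA -PM mulKmx.
apply: conj_trans cM _; apply: conj_eq; first by rewrite size_map size_enum_ord.
move=> i j i' j' ii jj; rewrite dseqE mxE -2!(inj_eq val_inj) /= ii jj.
by rewrite (nth_map ord0) ?size_enum_ord -?ii // nth_ord_enum.
Qed.

(** Sylvester's determinant identity: one block matrix is factored in two ways into triangular
    ones. *)
Lemma det_1D_mul d (u : 'cV[F]_d) (v : 'rV[F]_d) c : v *m u = c%:M ->
  \det (1%:M + u *m v) = 1 + c.
Proof.
move=> vu.
have e1 : block_mx (1%:M : 'M_1) v (- u) 1%:M =
    block_mx 1%:M 0 (- u) 1%:M *m block_mx 1%:M v 0 (1%:M + u *m v).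
  rewrite mulmx_block !mulmx1 !mul1mx !mul0mx !addr0 mulNmx.
  by rewrite addrCA addNr addr0.
have e2 : block_mx (1%:M : 'M_1) v (- u) 1%:M =
    block_mx (1%:M + v *m u) v 0 1%:M *m block_mx 1%:M 0 (- u) 1%:M.
  rewrite mulmx_block !mulmx1 !mulmx0 !mul1mx !add0r mulmxN.
  by rewrite addrK.
have := congr1 determinant e2; rewrite e1 !det_mulmx !det_lblock !det_ublock.
by rewrite !det1 !mul1r !mulr1 vu -raddfD det_scalar1.
Qed.

(** The matrix is annihilated by (X - 1)(X - c) with c different from 1, so it is diagonalizable
    with eigenvalues among 1 and c; the trace shows that c occurs exactly once. *)
Lemma conj_rank_one d (u : 'cV[F]_d) (v : 'rV[F]_d) c : v *m u = (c - 1)%:M ->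
  c != 1 -> conjugate_mx (1%:M + u *m v) (dseq (c :: nseq d.-1 1)).
Proof.
move=> vu c1; set A := _ + _.
have hA : \prod_(x <- [:: 1; c]) (A - x%:M) = 0.
  rewrite !big_cons big_nil mulr1 /A [X in X * _]addrC addKr -mulmxE.
  rewrite !mulmxDr mulmxN mulmx1 mul_mx_scalar -mulmxA [v *m _]mulmxA vu.
  rewrite mul_scalar_mx -scalemxAr scalerBl scale1r addrAC.
  by rewrite addrA subrK subrr.
have [|e ers cA] := conj_annihilated _ hA; first by rewrite /= inE eq_sym c1.
have sz := conj_size cA.
have trA : \tr A = \sum_(x <- e) x.
  have [P [Q [PQ QP ->]]] := cA; rewrite mxtrace_mulC mulmxA QP mul1mx.
  rewrite mxtrace_diag (big_nth 0) big_mkord.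
  by apply: eq_bigr => i _; rewrite mxE.
have trA' : \tr A = d%:R + (c - 1).
  by rewrite mxtraceD mxtrace1 mxtrace_mulC vu mxtrace_scalar.
have pe : perm_eq e (nseq (count_mem c e) c ++ nseq (count (predC1 c) e) 1).
  rewrite -(perm_filterC (pred1 c)).
  have -> : [seq x <- e | pred1 c x] = nseq (count_mem c e) c.
    rewrite -size_filter; apply/all_pred1P/allP=> x; rewrite mem_filter.
    by case/andP.
  have -> // : [seq x <- e | predC (pred1 c) x] = nseq (count (predC1 c) e) 1.
  rewrite -size_filter; apply/all_pred1P/allP=> x; rewrite mem_filter /=.
  by case/andP=> xc /ers; rewrite !inE (negPf xc) orbF.
have szc : (count_mem c e + count (predC1 c) e)%N = d.
  by rewrite sz (perm_size pe) // size_cat !size_nseq.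
(* With a the multiplicity of [c], the two traces give a (c - 1) = c - 1; characteristic zero brings
   this back to natural numbers. *)
have c_1 : count_mem c e = 1%N.
  apply/eqP; rewrite -(eqr_nat F); move: c1; rewrite -subr_eq0 => c1.
  apply/eqP/(mulIf c1); have : \sum_(x <- e) x = d%:R + (c - 1) by rewrite -trA.
  rewrite (perm_big _ pe) big_cat /= !big_nseq !iter_addr_0 -szc natrD.
  rewrite -[c *+ _]mulr_natl => eq; apply: (addIr (count (predC1 c) e)%:R).
  move: eq; set a := _%:R; set b := _%:R => eq.
  have -> : a * (c - 1) + b = (a * c + b) - a by ring.
  by rewrite eq; ring.
apply: conj_trans cA (conj_perm _); rewrite (perm_trans pe) // c_1 /=.
by rewrite -szc c_1 add1n.
Qed.
End RankOne.

(** * Fixed spaces, ranks and pseudo-reflections *)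

Section FixedSpaces.
Variable F : numFieldType.
Implicit Types (e f : seq F).

Lemma fixed_spaceE d (M : 'M[F]_d) x : (x \in fixed_space M) = (M *m x == x).
Proof.
by rewrite memv_ker lfunE /= mulmxBl mul1mx subr_eq0.
Qed.

(** The fixed space is the image of the injective map [g], which turns coordinates along a basis of
    the kernel of the transpose into column vectors. *)
Lemma fixed_codimE d (M : 'M[F]_d) : fixed_codim M = \rank (M - 1%:M).
Proof.
pose B := row_base (kermx (M - 1%:M)^T).
pose g := fun r : 'rV[F]_(\rank (kermx (M - 1%:M)^T)) => (r *m B)^T.
have g_lin : linear g by move=> a x y; rewrite /g mulmxDl -scalemxAl linearP.
pose gL := HB.pack g (GRing.isLinear.Build _ _ _ _ _ g_lin) : {linear _ -> _}.
have gi : lker (linfun gL) == 0%VS.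
  apply/lker0P => x y; rewrite !lfunE /= => /trmx_inj.
  by apply: row_free_inj; apply: row_base_free.
have gK : limg (linfun gL) = fixed_space M.
  apply/vspaceP=> x; apply/idP/idP.
    move=> /memv_imgP[r _ ->]; rewrite lfunE /= fixed_spaceE -subr_eq0.
    rewrite -[X in _ - X]mul1mx -mulmxBl.
    rewrite -[M - _]trmxK -trmx_mul -mulmxA.
    have : (B <= kermx (M - 1%:M)^T)%MS by rewrite eq_row_base.
    by move/sub_kermxP => ->; rewrite mulmx0 trmx0.
  rewrite fixed_spaceE -subr_eq0 -[X in _ - X]mul1mx -mulmxBl => /eqP Mx.
  have : (x^T <= B)%MS.
    by rewrite eq_row_base; apply/sub_kermxP; rewrite -trmx_mul Mx trmx0.
  case/submxP=> r rB; apply/memv_imgP; exists r; rewrite ?memvf // lfunE /= /g.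
  by rewrite -rB trmxK.
rewrite /fixed_codim -gK limg_dim_eq ?(eqP gi) ?capv0 // dimvf /dim /= mul1n.
by rewrite mxrank_ker mxrank_tr subKn // rank_leq_row.
Qed.

Lemma conj_rank d m (M : 'M[F]_d) (N : 'M[F]_m) :
  conjugate_mx M N -> (\rank M <= \rank N)%N.
Proof.
move=> [P [Q [_ _ ->]]].
by apply: leq_trans (mxrankM_maxl _ _) _; apply: mxrankM_maxr.
Qed.

Lemma conj_rankE d m (M : 'M[F]_d) (N : 'M[F]_m) :
  conjugate_mx M N -> \rank M = \rank N.
Proof.
move=> MN; apply/eqP; rewrite eqn_leq conj_rank // conj_rank //.
exact: conj_sym.
Qed.

Lemma conj_sub_scalar d m (M : 'M[F]_d) (N : 'M[F]_m) c :
  conjugate_mx M N -> conjugate_mx (M - c%:M) (N - c%:M).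
Proof.
move=> [P [Q [PQ QP ->]]]; exists P, Q; split=> //.
by rewrite mulmxBr mulmxBl mul_mx_scalar -scalemxAl PQ scalemx1.
Qed.

Lemma rank_conj_simple d (M : 'M[F]_d) x y m :
  conjugate_mx M (dseq (x :: nseq m y)) -> x != y -> \rank (M - y%:M) = 1%N.
Proof.
move=> /(conj_sub_scalar y) /conj_rankE -> xy.
have -> : dseq (x :: nseq m y) - y%:M = (x - y) *: delta_mx ord0 ord0.
  apply/matrixP=> i j; rewrite mxE dseqE !mxE.
  case: (unliftP ord0 i) => [i'|] -> /=; last first.
    by case: (unliftP ord0 j) => [j'|] ->; rewrite /= ?subrr ?mulr0 ?mulr1.
  have i'm : (0 + i' < m)%N by rewrite -[X in (_ < X)%N](size_nseq m y) add0n.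
  rewrite nth_nseq i'm.
  by rewrite subrr mulr0.
by rewrite mxrank_scale_nz ?mxrank_delta // subr_eq0.
Qed.

Lemma pseudo_reflection_rank_one d (u : 'cV[F]_d) (v : 'rV[F]_d) c :
  v *m u = (c - 1)%:M -> c != 0 -> c != 1 ->
  pseudo_reflection (1%:M + u *m v) c.
Proof.
move=> vu c0 c1; have cA := conj_rank_one vu c1; split; last exact/eqP.
- rewrite (unit_conj cA) // inE negb_or eq_sym c0 /=.
  by apply/negP => /nseqP[/esym/eqP]; rewrite oner_eq0.
- by rewrite fixed_codimE (rank_conj_simple cA).
- by rewrite (det_1D_mul vu) addrC subrK.
Qed.

Lemma rank_one_mul m n (A : 'M[F]_(m, n)) : \rank A = 1%N ->
  exists (u : 'cV[F]_m) (v : 'rV[F]_n), A = u *m v.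
Proof.
move=> r1; have := mulmx_base A.
by move: (col_base A) (row_base A); rewrite r1 => u v <-; exists u, v.
Qed.

(** The rank one matrix [M - 1%:M] factors as [u *m v], and the determinant of [M] fixes the scalar
    [v *m u]. *)
Lemma conj_pseudo_reflection d (M : 'M[F]_d) c : pseudo_reflection M c ->
  conjugate_mx M (dseq (c :: nseq d.-1 1)).
Proof.
case=> _; rewrite fixed_codimE => /rank_one_mul[u [v Muv]] dM /eqP c1.
have -> : M = 1%:M + u *m v by rewrite -Muv addrC subrK.
apply: conj_rank_one => //; rewrite [v *m u]mx11_scalar; congr (_%:M).
rewrite -dM -[in RHS](subrK 1%:M M) Muv [u *m v + _]addrC.
by rewrite (det_1D_mul (mx11_scalar _)) addrAC subrr add0r.
Qed.
End FixedSpaces.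

(** * Disjoint spectra and irreducibility *)

Section Coprime.
Variable F : numFieldType.
Implicit Types (e f : seq F).

Lemma horner_mx_sum d (A : 'M[F]_d.+1) (p : {poly F}) :
  horner_mx A p = \sum_(i < size p) p`_i *: A ^+ i.
Proof.
rewrite -{1}[p]coefK poly_def rmorph_sum /=; apply: eq_bigr => i _.
by rewrite linearZ /= rmorphXn /= horner_mx_X.
Qed.

Lemma horner_mx_conj d (M : 'M[F]_d.+1) e : conjugate_mx M (dseq e) ->
  horner_mx M (\prod_(x <- e) ('X - x%:P)) = 0.
Proof.
move=> cM; have ed := conj_size cM; case: e ed cM => // x e [ed]; subst d => -[P [Q [PQ QP ->]]].
have uP : P \in unitmx by apply: (mulmx1_unit PQ).1.
have -> : Q = invmx P by rewrite -[Q]mul1mx -(mulVmx uP) -mulmxA PQ mulmx1.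
rewrite horner_mx_uconj // horner_mx_diag.
rewrite [X in diag_mx X](_ : _ = 0) ?linear0 ?mulmx0 ?mul0mx //.
apply/rowP=> i; rewrite !mxE; apply/eqP; rewrite -/(root _ _) root_prod_XsubC.
by rewrite mem_nth.
Qed.

Lemma coprimep_prod_XsubC e f : (forall x, x \in e -> x \notin f) ->
  coprimep (\prod_(x <- e) ('X - x%:P)) (\prod_(x <- f) ('X - x%:P)).
Proof.
elim: e => [|x e IH] ef; first by rewrite big_nil coprime1p.
rewrite big_cons coprimepMl IH => [|y ye]; last by rewrite ef // inE ye orbT.
by rewrite coprimep_sym coprimep_XsubC root_prod_XsubC ef ?mem_head.
Qed.

(** Polynomials in [M] and in [N] agree at [x]. A Bezout relation between the two annihilating
    polynomials is evaluated at [N] and applied to [x]: one term dies by [N], the other, read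
    through [M], dies by [M]. *)
Lemma coprime_eq0 d (M N : 'M[F]_d) e f x :
  conjugate_mx M (dseq e) -> conjugate_mx N (dseq f) ->
  (forall y, y \in e -> y \notin f) ->
  (forall m, M ^+ m *m x = N ^+ m *m x) -> x = 0 :> 'cV_d.
Proof.
case: d M N x => [|d] M N x cM cN ef MN; first by apply/colP=> -[].
have MNp p : horner_mx M p *m x = horner_mx N p *m x.
  rewrite !horner_mx_sum !mulmx_suml; apply: eq_bigr => i _.
  by rewrite -!scalemxAl MN.
have /Bezout_coprimepP[[p q] /= /eqpP[[a b] /= /andP[a0 b0] pq]] :=
  coprimep_prod_XsubC ef.
have := congr1 (fun p => horner_mx N p *m x) pq.
rewrite !linearZ /= rmorphD !rmorphM /= (horner_mx_conj cN) mulr0 addr0 rmorph1.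
rewrite -!scalemxAl -mulmxE -mulmxA -MNp (horner_mx_conj cM) mul0mx mulmx0 scaler0.
by rewrite mul1mx => /esym/eqP; rewrite scaler_eq0 (negPf b0) => /eqP.
Qed.

(** Dual of [coprime_eq0]: modulo [U] the two operators coincide, so the quotient by [U] is zero.
    Instead of forming the quotient, differences are tracked inside [U]. *)
Lemma coprime_fullv d (M N : 'M[F]_d) e f (U : {vspace 'cV[F]_d}) :
  conjugate_mx M (dseq e) -> conjugate_mx N (dseq f) ->
  (forall y, y \in e -> y \notin f) ->
  (forall x, x \in U -> M *m x \in U) -> (forall x, x \in U -> N *m x \in U) ->
  (forall x, M *m x - N *m x \in U) -> U = fullv.
Proof.
case: d M N U => [|d] M N U cM cN ef MU NU MNU.
  by apply/vspaceP=> x; rewrite memvf [x](_ : x = 0) ?mem0v //; apply/colP=> -[].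
have expU m x : M ^+ m *m x - N ^+ m *m x \in U.
  elim: m => [|m IH]; first by rewrite !expr0 subrr mem0v.
  rewrite !exprS -!mulmxE -!mulmxA.
  have -> : M *m (M ^+ m *m x) - N *m (N ^+ m *m x) =
     M *m (M ^+ m *m x - N ^+ m *m x) + (M *m (N ^+ m *m x) - N *m (N ^+ m *m x)).
    by rewrite mulmxBr addrA subrK.
  by rewrite memvD // MU.
have MNp p x : horner_mx M p *m x - horner_mx N p *m x \in U.
  rewrite !horner_mx_sum !mulmx_suml -sumrB; apply: memv_suml => i _.
  by rewrite -!scalemxAl -scalerBr memvZ.
have NpU p x : x \in U -> horner_mx N p *m x \in U.
  move=> xU; rewrite horner_mx_sum mulmx_suml; apply: memv_suml => i _.
  rewrite -scalemxAl memvZ //; elim: (i : nat) => [|m IH]; first by rewrite mul1mx.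
  by rewrite exprS -mulmxE -mulmxA NU.
have /Bezout_coprimepP[[p q] /= /eqpP[[a b] /= /andP[a0 b0] pq]] :=
  coprimep_prod_XsubC ef.
apply/vspaceP=> x; rewrite memvf.
have := congr1 (fun p => horner_mx N p *m x) pq.
rewrite !linearZ /= rmorphD !rmorphM /= (horner_mx_conj cN) mulr0 addr0 rmorph1.
rewrite -!scalemxAl -mulmxE -mulmxA mul1mx => bx.
rewrite -[x]scale1r -(mulVf b0) -scalerA -bx !memvZ // NpU //.
by rewrite -memvN; have := MNp (\prod_(x0 <- e) ('X - x0%:P)) x;
  rewrite (horner_mx_conj cM) mul0mx sub0r.
Qed.

(** The nonzero pairings connect the reflections: a single [v i] not vanishing on [U] puts [u i],
    then every [u j], into [U], and [coprime_fullv] applies. If all [v i] vanish on [U], then [M]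
    and [N] agree there and [coprime_eq0] applies. *)
Lemma irreducible_core d l (u : 'I_l -> 'cV[F]_d) (v : 'I_l -> 'rV[F]_d)
    (M N : 'M[F]_d) e f (U : {vspace 'cV[F]_d}) :
  conjugate_mx M (dseq e) -> conjugate_mx N (dseq f) ->
  (forall y, y \in e -> y \notin f) ->
  M = \prod_(i < l) (1%:M + u i *m v i) *m N ->
  (forall i j, i != j -> v i *m u j != 0) ->
  (forall i x, x \in U -> (1%:M + u i *m v i) *m x \in U) ->
  (forall x, x \in U -> M *m x \in U) -> (forall x, x \in U -> N *m x \in U) ->
  U = 0%VS \/ U = fullv.
Proof.
move=> cM cN ef eM uv AU MU NU.
have uvx i (x : 'cV_d) : (1%:M + u i *m v i) *m x = x + (v i *m x) 0 0 *: u i.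
  by rewrite mulmxDl mul1mx -mulmxA {1}[v i *m x]mx11_scalar mul_mx_scalar.
have mem_u i x : x \in U -> v i *m x != 0 -> u i \in U.
  move=> xU vx; have := AU i x xU; rewrite uvx => /memvB /(_ xU).
  rewrite addrAC subrr add0r => /(memvZ ((v i *m x) 0 0)^-1).
  rewrite scalerA mulVf ?scale1r //; apply: contraNneq vx => vx0.
  by rewrite [_ *m _]mx11_scalar vx0 raddf0.
have [[i [x [xU vx]]]|noix] :=
  pselect (exists i x, x \in U /\ v i *m x != 0); [right|left].
  have ui := mem_u i x xU vx.
  have uU j : u j \in U.
    by have [<- //|ij] := eqVneq i j; apply: (mem_u j (u i)) => //; rewrite uv // eq_sym.
  apply: (coprime_fullv cM cN ef) => // y; rewrite eM -mulmxA.
  move: (N *m y) => {}y.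
  move: y; apply: (big_ind (fun B : 'M[F]_d => forall y : 'cV_d, B *m y - y \in U)).
  - by move=> z; rewrite mul1mx subrr mem0v.
  - move=> A B hA hB z; rewrite -mulmxE -mulmxA.
    by rewrite -(subrK (B *m z) (A *m _)) -addrA memvD.
  - by move=> j _ z; rewrite uvx addrAC subrr add0r memvZ.
apply/eqP; rewrite -subv0; apply/subvP=> x xU; rewrite memv0.
have vU i y : y \in U -> v i *m y = 0.
  by move=> yU; apply/eqP/negPn/negP=> vy; case: noix; exists i, y.
have MN y : y \in U -> M *m y = N *m y.
  move=> /NU; rewrite eM -mulmxA; move: (N *m y) => {}y yU.
  apply: (big_ind (fun B : 'M[F]_d => B *m y = y)); first by rewrite mul1mx.
    by move=> A B hA hB; rewrite -mulmxE -mulmxA hB.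
  by move=> i _; rewrite uvx vU // mxE scale0r addr0.
apply/eqP/(coprime_eq0 cM cN ef) => m.
suff /(_ m)[] : forall m, M ^+ m *m x = N ^+ m *m x /\ M ^+ m *m x \in U by [].
elim=> [|{}m [IH1 IH2]]; first by rewrite !expr0 mul1mx.
by rewrite !exprS -!mulmxE -!mulmxA -IH1 -MN // MU.
Qed.
End Coprime.

(** * Scott's lemma and operators on spaces of matrices *)

Section Scott.
Variable F : fieldType.

(** Telescoping g P - 1 = (g - 1) P + (P - 1), with each g - 1 factored through its rank, writes the
    product minus one as [D *m E] through a space whose dimension is the sum of the ranks. *)
Lemma scott_factor n (gs : seq 'M[F]_n) :
  exists (r : nat) (D : 'M[F]_(n, r)) (E : 'M[F]_(r, n)),
  [/\ r = (\sum_(g <- gs) \rank (g - 1%:M)%R)%N,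
      D *m E = \prod_(g <- gs) g - 1%:M,
      forall u : 'rV_n, u *m D = 0 -> forall g, g \in gs -> u *m g = u
    & forall w : 'cV_n, E *m w = 0 -> forall g, g \in gs -> g *m w = w].
Proof.
elim: gs => [|g gs [r [D [E [er DE Du Ew]]]]].
  exists 0%N, 0, 0; rewrite !big_nil mulmx0; split=> //.
  by rewrite subrr.
pose P := \prod_(g <- gs) g.
exists (\rank (g - 1%:M)%R + r)%N, (row_mx (col_base (g - 1%:M)) D),
  (col_mx (row_base (g - 1%:M) *m P) E); split.
- by rewrite big_cons er.
- rewrite mul_row_col mulmxA mulmx_base DE big_cons -/P mulmxBl mul1mx -mulmxE.
  by rewrite addrA subrK.
- move=> u; rewrite mul_mx_row => /eqP; rewrite row_mx_eq0 => /andP[/eqP ug /eqP uD].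
  move=> h; rewrite inE => /orP[/eqP ->|hg]; last exact: Du.
  apply/eqP; rewrite -subr_eq0 -[X in _ - X]mulmx1 -mulmxBr -(mulmx_base (g - _)).
  by rewrite mulmxA ug mul0mx.
- move=> w; rewrite mul_col_mx => /eqP; rewrite col_mx_eq0 => /andP[/eqP gw /eqP Ew0].
  move=> h; rewrite inE => /orP[/eqP ->|hg]; last exact: Ew.
  (* A vector killed by [E] is fixed by the tail product [P], which removes [P] from the new top
     block. *)
  have Pw : P *m w = w.
    apply/eqP; rewrite -subr_eq0 -[X in _ - X]mul1mx -mulmxBl -DE.
    by rewrite -mulmxA Ew0 mulmx0.
  apply/eqP; rewrite -subr_eq0 -[X in _ - X]mul1mx -mulmxBl -(mulmx_base (g - _)).
  by move: gw; rewrite -!mulmxA Pw => ->; rewrite !mulmx0.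
Qed.

Lemma not_row_free_ker m n (D : 'M[F]_(m, n)) : (\rank D < m)%N ->
  exists2 u : 'rV_m, u != 0 & u *m D = 0.
Proof.
move=> rD; have /rowV0Pn[u uk u0] : kermx D != 0.
  by rewrite kermx_eq0 /row_free ltn_eqF.
by exists u => //; apply/sub_kermxP.
Qed.

(** When the product is one, [D *m E] vanishes, so the ranks of [D] and [E] add up to less than 2n
    and one of them is below n. *)
Lemma scott n (gs : seq 'M[F]_n) : \prod_(g <- gs) g = 1%:M ->
  (\sum_(g <- gs) \rank (g - 1%:M)%R < n + n)%N ->
  (exists2 u : 'rV_n, u != 0 & forall g, g \in gs -> u *m g = u) \/
  (exists2 w : 'cV_n, w != 0 & forall g, g \in gs -> g *m w = w).
Proof.
move=> gs1; have [r [D [E [<-]]]] := scott_factor gs.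
rewrite gs1 subrr => /mulmx0_rank_max le Du Ew lt.
have [rD|rD] := ltnP (\rank D) n.
  by left; have [u u0 uD] := not_row_free_ker rD; exists u => //; apply: Du.
right; have /not_row_free_ker[u u0 uE] : (\rank E^T < n)%N.
  by rewrite mxrank_tr; lia.
exists u^T; first by rewrite -trmx0 (inj_eq trmx_inj).
by apply: Ew; rewrite -[E]trmxK -trmx_mul uE trmx0.
Qed.

Section Operators.
Variables d' d : nat.

(** The operator X -> P X Q on vectorized matrices. It acts on the right of row vectors, hence the
    reversed order of the left factors in [two_sidedM]. *)
Definition two_sided (P : 'M[F]_d') (Q : 'M[F]_d) : 'M[F]_(d' * d) :=
  lin_mulmx P *m lin_mulmxr Q.

Lemma mul_two_sided X P Q :
  mxvec X *m two_sided P Q = mxvec (P *m X *m Q) :> 'rV_(d' * d).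
Proof. by rewrite /two_sided mulmxA !mul_vec_lin. Qed.

Lemma eq_mxvec_mul n (A B : 'M[F]_(d' * d, n)) :
  (forall X : 'M_(d', d), mxvec X *m A = mxvec X *m B) -> A = B.
Proof.
move=> AB; apply/row_matrixP=> i; rewrite !rowE.
by rewrite -[delta_mx 0 i]vec_mxK AB.
Qed.

Lemma two_sidedM P Q P' Q' :
  two_sided P Q *m two_sided P' Q' = two_sided (P' *m P) (Q *m Q').
Proof.
by apply: eq_mxvec_mul => X; rewrite mulmxA !mul_two_sided !mulmxA.
Qed.

Lemma two_sided1 : two_sided 1%:M 1%:M = 1%:M.
Proof.
by apply: eq_mxvec_mul => X; rewrite mul_two_sided !mulmx1 mul1mx.
Qed.

(** A fixed column is an invariant linear form on matrices; through the trace pairing it becomes a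
    matrix in the opposite direction. The identity is tested against elementary matrices. *)
Lemma two_sided_colP (w : 'cV[F]_(d' * d)) P Q : two_sided P Q *m w = w ->
  Q *m (vec_mx w^T)^T *m P = (vec_mx w^T)^T.
Proof.
pose Y := vec_mx w^T; have -> : w = (mxvec Y)^T by rewrite vec_mxK trmxK.
rewrite trmxK mxvecK => Tw; apply: trmx_inj; rewrite !trmx_mul !trmxK.
apply/row_matrixP=> i; rewrite !rowE; apply: trmx_inj.
apply/row_matrixP=> j; rewrite !rowE; apply: trmx_inj.
rewrite [LHS]trmx_mul [RHS]trmx_mul !trmxK.
have := congr1 (mulmx (mxvec ((delta_mx 0 i : 'rV_d')^T *m (delta_mx 0 j : 'rV_d)))) Tw.
rewrite mulmxA mul_two_sided mxvec_dotmul => <-.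
have -> : P *m ((delta_mx 0 i : 'rV_d')^T *m (delta_mx 0 j : 'rV_d)) *m Q =
    ((delta_mx 0 i : 'rV_d') *m P^T)^T *m ((delta_mx 0 j : 'rV_d) *m Q).
  by rewrite trmx_mul trmxK !mulmxA.
by rewrite mxvec_dotmul trmx_mul !mulmxA.
Qed.

Lemma rank_diag_le n (w : 'rV[F]_n) : (\rank (diag_mx w) <= \sum_(i < n) (w 0%R i != 0%R))%N.
Proof.
rewrite diag_mx_sum_delta.
apply: (big_ind2 (fun (A : 'M[F]_n) m => (\rank A <= m)%N)).
- by rewrite mxrank0.
- by move=> A m B p Am Bp; apply: leq_trans (mxrank_add _ _) (leq_add Am Bp).
- move=> i _; case: eqP => [->|_]; first by rewrite scale0r mxrank0.
  by apply: leq_trans (mxrank_scale _ _) _; rewrite mxrank_delta.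
Qed.
End Operators.
End Scott.

(** * Intertwiners and Schur's lemma *)

Section Katz.
Variable F : numFieldType.
Implicit Types (e f : seq F).

(** Up to an invertible factor, the operator minus one is X -> X B - A X, which in eigenbases is
    diagonal, with entries the differences between eigenvalues of [B] and of [A]. *)
Lemma rank_two_sided d' d (A : 'M[F]_d') (B : 'M[F]_d) e' e :
  conjugate_mx A (dseq e') -> conjugate_mx B (dseq e) -> A \in unitmx ->
  (\rank (two_sided (invmx A) B - 1%:M)%R <=
     \sum_(x <- e') \sum_(y <- e) (x != y))%N.
Proof.
move=> cA cB uA.
have ed' := conj_size cA; have ed := conj_size cB; subst d' d.
have [P' [Q' [PQ' QP' eA]]] := cA; have [P [Q [PQ QP eB]]] := cB.
have -> : two_sided (invmx A) B - 1%:M =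
    (two_sided 1%:M B - two_sided A 1%:M) *m two_sided (invmx A) 1%:M.
  by rewrite mulmxBl !two_sidedM !mulmx1 mulVmx // two_sided1.
apply: leq_trans (mxrankM_maxl _ _) _.
have -> : two_sided 1%:M B - two_sided A 1%:M = two_sided Q' P *m
    (two_sided 1%:M (dseq e) - two_sided (dseq e') 1%:M) *m two_sided P' Q.
  rewrite mulmxBr mulmxBl !two_sidedM !mulmx1 !mul1mx !mulmxA PQ' PQ.
  by rewrite -eA -eB.
apply: leq_trans (mxrankM_maxl _ _) _; apply: leq_trans (mxrankM_maxr _ _) _.
have -> : two_sided 1%:M (dseq e) - two_sided (dseq e') 1%:M =
    diag_mx (mxvec (\matrix_(i < size e', j < size e) (e`_j - e'`_i))).
  apply: eq_mxvec_mul => X; rewrite mulmxBr !mul_two_sided mul1mx mulmx1 -linearB.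
  apply/rowP=> k; case/mxvec_indexP: k => i j.
  rewrite mxvecE /dseq mul_diag_mx !mul_mx_diag !mxE !mxvecE !mxE.
  by rewrite mulrBr [e'`_i * _]mulrC.
apply: leq_trans (rank_diag_le _) _.
rewrite (big_nth 0) big_mkord.
under [X in (_ <= X)%N]eq_bigr do rewrite (big_nth 0) big_mkord.
rewrite pair_big /= (reindex _ (curry_mxvec_bij _ _)) /=.
by apply: leq_sum => -[i j] _; rewrite mxvecE mxE subr_eq0 eq_sym.
Qed.

(** Scott's lemma on Hom, for the operators X -> g.1^-1 X g.2: a fixed row is an intertwiner [X], a
    fixed column is an intertwiner [Y] in the opposite direction. *)
Lemma intertwiner_exists d' d (gs : seq ('M[F]_d' * 'M[F]_d)) :
  {in gs, forall g, g.1 \in unitmx} ->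
  \prod_(g <- gs) g.1 = 1%:M -> \prod_(g <- gs) g.2 = 1%:M ->
  (\sum_(g <- gs) \rank (two_sided (invmx g.1) g.2 - 1%:M)%R < d' * d + d' * d)%N ->
  (exists2 X : 'M[F]_(d', d), X != 0 & {in gs, forall g, X *m g.2 = g.1 *m X}) \/
  (exists2 Y : 'M[F]_(d, d'), Y != 0 & {in gs, forall g, Y *m g.1 = g.2 *m Y}).
Proof.
move=> gu g1 g2 lt.
pose hs := [seq two_sided (invmx g.1) g.2 | g <- gs].
(* The reversal of left factors in [two_sidedM] matches the reversal of products under inversion. *)
have hP : \prod_(h <- hs) h = 1%:M.
  rewrite /hs big_map -two_sided1 -invmx1 -g1 -g2.
  elim: gs gu {g1 g2 lt hs} => [|g gs IH] gu.
    by rewrite !big_nil invmx1 two_sided1.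
  rewrite !big_cons IH => [|h hg]; last by rewrite gu // inE hg orbT.
  rewrite -!mulmxE two_sidedM; congr (two_sided _ _).
  have u1 : g.1 \in unitmx by rewrite gu ?mem_head.
  have u2 : \prod_(j <- gs) j.1 \in unitmx.
    rewrite big_seq; apply: (big_ind (fun B : 'M[F]_d' => B \in unitmx)).
    - exact: unitmx1.
    - by move=> A B uA uB; rewrite -mulmxE unitmx_mul uA.
    - by move=> h hg; rewrite gu // inE hg orbT.
  have uu : g.1 *m \prod_(j <- gs) j.1 \in unitmx by rewrite unitmx_mul u1.
  apply: (can_inj (mulKmx uu)); rewrite mulmxV // -mulmxA (mulmxA _ (invmx _)).
  by rewrite mulmxV // mul1mx mulmxV.
have := scott hP; rewrite big_map => /(_ lt)[[u u0 uh]|[w w0 wh]].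
- left; exists (vec_mx u); first by rewrite -(inj_eq (can_inj mxvecK)) vec_mxK linear0.
  move=> g gg; have := uh _ (map_f _ gg); rewrite -{1 2}[u]vec_mxK mul_two_sided.
  move/(can_inj mxvecK)/(congr1 (mulmx g.1)).
  by rewrite !mulmxA mulmxV ?mul1mx // gu.
- right; exists (vec_mx w^T)^T.
    rewrite -trmx0 (inj_eq trmx_inj) -(inj_eq (can_inj mxvecK)) vec_mxK linear0.
    by rewrite -trmx0 (inj_eq trmx_inj).
  move=> g gg; have := two_sided_colP (wh _ (map_f _ gg)).
  by move/(congr1 (mulmx^~ g.1)); rewrite -!mulmxA mulVmx ?gu // mulmx1.
Qed.

Lemma eq_mx0_col m n (A : 'M[F]_(m, n)) : (forall x : 'cV_n, A *m x = 0) -> A = 0.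
Proof.
by move=> A0; apply: trmx_inj; apply/row_matrixP=> i; rewrite trmx0 row0 rowE;
  apply: trmx_inj; rewrite trmx_mul trmxK A0 trmx0.
Qed.

(** Schur's lemma with irreducibility assumed on one side: the kernel of [X] and the image of [Y]
    both lie in the space of the second system, and equal ranks make injectivity or surjectivity
    sufficient. *)
Lemma intertwiner_invertible d' d (gs : seq ('M[F]_d' * 'M[F]_d)) : d' = d ->
  (forall U : {vspace 'cV[F]_d},
     {in gs, forall g, {in U, forall x, g.2 *m x \in U}} ->
     U = 0%VS \/ U = fullv) ->
  (exists2 X : 'M[F]_(d', d), X != 0 & {in gs, forall g, X *m g.2 = g.1 *m X}) \/
  (exists2 Y : 'M[F]_(d, d'), Y != 0 & {in gs, forall g, Y *m g.1 = g.2 *m Y}) ->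
  exists (P : 'M[F]_(d', d)) (Q : 'M[F]_(d, d')),
    [/\ P *m Q = 1%:M, Q *m P = 1%:M & {in gs, forall g, g.1 = P *m g.2 *m Q}].
Proof.
move=> ed; subst d' => irr [[X X0 Xg]|[Y Y0 Yg]].
- have uX : X \in unitmx.
    rewrite -unitmx_tr -row_free_unit -kermx_eq0.
    have [|k0|kT] := irr (lker (linfun (mulmx X : 'cV_d -> 'cV_d))).
    + move=> g gg x; rewrite !memv_ker !lfunE /= mulmxA Xg // -mulmxA => /eqP ->.
      by rewrite mulmx0.
    + apply/eqP/row_matrixP=> i; rewrite row0; apply: trmx_inj; rewrite trmx0.
      apply/eqP; rewrite -memv0 -k0 memv_ker lfunE /=.
      have : (row i (kermx X^T) <= kermx X^T)%MS by apply: row_sub.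
      by move/sub_kermxP/(congr1 trmx); rewrite trmx_mul trmxK trmx0 => ->.
    + case/eqP: X0; apply: eq_mx0_col => x; apply/eqP.
      by have := memvf x; rewrite -kT memv_ker lfunE.
  exists X, (invmx X); split; rewrite ?mulmxV ?mulVmx // => g gg.
  by rewrite Xg // mulmxK.
- have uY : Y \in unitmx.
    have [|k0|kT] := irr (limg (linfun (mulmx Y : 'cV_d -> 'cV_d))).
    + move=> g gg x /memv_imgP[y _ ->]; rewrite !lfunE /= mulmxA -Yg // -mulmxA.
      by apply/memv_imgP; exists (g.1 *m y); rewrite ?memvf // lfunE.
    + case/eqP: Y0; apply: eq_mx0_col => x; apply/eqP.
      by rewrite -memv0 -k0; apply/memv_imgP; exists x; rewrite ?memvf // lfunE.
    + rewrite -row_free_unit -kermx_eq0; apply/eqP/row_matrixP=> i; rewrite row0.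
      apply: eq_mx0_col => x; have := memvf x.
      rewrite -kT => /memv_imgP[y _ ->]; rewrite lfunE /= mulmxA.
      have : (row i (kermx Y) <= kermx Y)%MS by apply: row_sub.
      by move/sub_kermxP => ->; rewrite mul0mx.
  exists (invmx Y), Y; split; rewrite ?mulmxV ?mulVmx // => g gg.
  by rewrite -mulmxA -Yg // mulKmx.
Qed.
End Katz.

(** * Companion matrices and hypergeometric pairs *)

Section Companion.
Variable F : numFieldType.
Implicit Types (e f : seq F).

Lemma conj_scale d (M : 'M[F]_d) e c : conjugate_mx M (dseq e) ->
  conjugate_mx (c *: M) (dseq [seq c * x | x <- e]).
Proof.
move=> [P [Q [PQ QP ->]]].
have c1 : conjugate_mx (c *: (P *m dseq e *m Q)) (c *: dseq e).
  by exists P, Q; rewrite -scalemxAr -scalemxAl.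
apply: conj_trans c1 _; apply: conj_eq; first by rewrite size_map.
move=> i j i' j' ii jj; rewrite mxE !dseqE -2!(inj_eq val_inj) /= ii jj.
by rewrite mulrnAr (nth_map 0) // -ii.
Qed.

Lemma char_poly_conj d m (M : 'M[F]_d) (N : 'M[F]_m) :
  conjugate_mx M N -> char_poly M = char_poly N.
Proof.
move=> cM; have ed := conj_size cM; subst m; have [P [Q [PQ QP ->]]] := cM.
rewrite /char_poly.
have -> : char_poly_mx (P *m N *m Q) =
    map_mx polyC P *m char_poly_mx N *m map_mx polyC Q.
  rewrite /char_poly_mx mulmxBr mulmxBl !map_mxM mul_mx_scalar -scalemxAl.
  by rewrite -[map_mx _ P *m map_mx _ Q]map_mxM PQ map_mx1 scalemx1.
by rewrite !det_mulmx mulrAC -det_mulmx -map_mxM PQ map_mx1 det1 mul1r.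
Qed.

(** Off the last row the entries do not depend on [e]; this is what makes two such matrices differ
    by rank at most one. *)
Lemma companion_exists d e : size e = d.+1 -> exists C : 'M[F]_d.+1,
  char_poly C = \prod_(x <- e) ('X - x%:P) /\
  forall i j, i != ord_max -> C i j = (i.+1 == j)%:R.
Proof.
move=> sz; pose p : {poly F} := \prod_(x <- e) ('X - x%:P).
have sp : (size p).-1 = d.+1 by rewrite size_prod_XsubC sz.
have pm : p \is monic by apply: monic_prod_XsubC.
have := companionmxK pm; rewrite -/p.
have : forall i j : 'I_(size p).-1, i != d :> nat -> companionmx p i j = (i.+1 == j)%:R.
  move=> i j id; rewrite mxE; have -> : ((size p).-1.-1 = d)%N by rewrite sp.
  by rewrite (negPf id).
move: (companionmx p); rewrite sp => C Cij Cp; exists C.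
by split=> // i j; apply: Cij.
Qed.

Lemma conj_char_poly d (C : 'M[F]_d.+1) e : uniq e ->
  char_poly C = \prod_(x <- e) ('X - x%:P) -> conjugate_mx C (dseq e).
Proof.
move=> ue Ce; have [|e' _ cC] := @conj_annihilated _ _ C e ue.
  rewrite -[RHS](Cayley_Hamilton C) Ce rmorph_prod /=; apply: eq_bigr => x _.
  by rewrite rmorphB /= horner_mx_X horner_mx_C.
apply: (conj_trans cC (conj_perm _)); apply: prod_XsubC_eq; rewrite -Ce.
rewrite (char_poly_conj cC) char_poly_trig ?diag_mx_is_trig //.
by rewrite (big_nth 0) big_mkord; apply: eq_bigr => i _; rewrite dseqE eqxx.
Qed.

(** Levelt's construction: companion matrices differ in the last row only, so M N^-1 is the identity
    plus [u *m v] with [u] the last basis vector; comparing determinants gives [v *m u]. *)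
Lemma hypergeometric_exists d e f : size e = d.+1 -> size f = d.+1 ->
  uniq e -> uniq f -> 0 \notin f ->
  exists (M N : 'M[F]_d.+1) (u : 'cV_d.+1) (v : 'rV_d.+1),
  [/\ conjugate_mx M (dseq e), conjugate_mx N (dseq f),
      M = (1%:M + u *m v) *m N
    & v *m u = ((\prod_(x <- e) x) / (\prod_(x <- f) x) - 1)%:M].
Proof.
move=> se sf ue uf f0.
have [M [/(conj_char_poly ue) cM Mij]] := companion_exists se.
have [N [/(conj_char_poly uf) cN Nij]] := companion_exists sf.
have uN := unit_conj cN f0.
pose u : 'cV[F]_d.+1 := delta_mx ord_max 0.
pose v := row ord_max (M - N) *m invmx N.
have MN : M = (1%:M + u *m v) *m N.
  rewrite mulmxDl mul1mx -mulmxA mulmxKV // addrC; apply/eqP; rewrite -subr_eq.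
  apply/eqP/matrixP=> i j; rewrite !mxE big_ord1 !mxE.
  by have [->|im] := eqVneq i ord_max; rewrite ?mul1r // mul0r Mij // Nij // subrr.
exists M, N, u, v; split=> //; rewrite [LHS]mx11_scalar; congr (_%:M).
have := det_conj cM; rewrite MN det_mulmx (det_1D_mul (mx11_scalar _)) (det_conj cN).
move=> <-; rewrite mulfK ?[1 + _]addrC ?addrK // -(det_conj cN).
by rewrite -unitfE -unitmxE.
Qed.
End Companion.

(** * Jordan-Pochhammer factorization into reflections *)

Section JordanPochhammer.
Variable F : numFieldType.
Variables (l : nat) (lam : 'I_l.+1 -> F) (mu eta : F).
Hypotheses (mu0 : mu != 0) (lam_mu : forall i, lam i != mu)
  (eta_mu : eta != mu) (prod_lam : \prod_i lam i = eta * mu ^+ l).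

(* The rows are chosen so that, writing [C - 1 = U + V] with [U] the strictly
   upper triangular part of the matrix [c_i], the matrix [1 + V - mu (1 - U)]
   has all its rows equal; the product of the reflections is
   [(1 - U)^-1 (1 + V)], which then differs from [mu] by a rank one matrix. *)
Definition jp_row (i : 'I_l.+1) : 'rV[F]_l.+1 :=
  \row_j (if (j < i)%N then lam j - mu
          else if j == i then lam i - 1 else (lam j - mu) / mu).

Let refl (i : 'I_l.+1) : 'M[F]_l.+1 := 1%:M + delta_mx i 0 *m jp_row i.

Lemma jp_rowE i j : jp_row i *m delta_mx j 0 = (jp_row i 0 j)%:M :> 'M_1.
Proof. by rewrite -colE [LHS]mx11_scalar mxE. Qed.

Lemma jp_row_neq0 i j : i != j -> jp_row i *m delta_mx j 0 != 0 :> 'M_1.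
Proof.
move=> ij; rewrite jp_rowE; apply/eqP=> /matrixP/(_ 0 0); rewrite !mxE eqxx mulr1n.
rewrite eq_sym (negPf ij); have lm := lam_mu j; rewrite -subr_eq0 in lm.
by apply/eqP; case: ifP => _ //; rewrite mulf_neq0 // invr_eq0.
Qed.

(** Induction on the tail product, from the last factor backwards: the tail starting at [s] is
    diagonal with entries 1 before [s] and [mu] from [s] on, plus a rank one term supported on the
    rows from [s] on. The next reflection changes a single row. *)
Lemma jp_prod : exists x : 'cV[F]_l.+1,
  \prod_i refl i = mu%:M + x *m \row_j (lam j - mu).
Proof.
pose B s := refl (inord s).
have key s : (s <= l.+1)%N -> exists x : 'cV[F]_l.+1,
    (forall a : 'I_l.+1, (a < s)%N -> x a 0 = 0) /\
    \prod_(s <= i < l.+1) B i = \matrix_(a, b)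
      ((if (a < s)%N then 1 else mu) *+ (a == b) + x a 0 * (lam b - mu)).
  move=> sl; rewrite -(subKn sl); move: (leq_subr s l.+1).
  elim: (l.+1 - s)%N => [|t IH] tl.
    rewrite subn0 big_geq //; exists 0; split=> [a _|]; first by rewrite mxE.
    by apply/matrixP=> a b; rewrite !mxE ltn_ord mul0r addr0.
  have [x [x0 Bx]] := IH (ltnW tl).
  set s' := (l.+1 - t.+1)%N; have s's : s'.+1 = (l.+1 - t)%N by lia.
  rewrite big_ltn; last by lia.
  rewrite s's Bx.
  have s'l : (s' < l.+1)%N by lia.
  pose i0 := Ordinal s'l.
  have -> : B s' = refl i0 by congr refl; apply: val_inj; rewrite /= inordK.
  (* [y] pairs the new row with the rank one part; row [s'] of the rank one term receives the
     coefficient 1 + y. *)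
  pose y := \sum_j jp_row i0 0 j * x j 0.
  exists (\col_a (if a == i0 then 1 + y else x a 0)); split.
    move=> a asl; rewrite mxE -(inj_eq val_inj) /= ltn_eqF // x0 //.
    by apply: (ltn_trans asl); rewrite -s's.
  apply/matrixP=> a b; rewrite -mulmxE mulmxDl mul1mx -mulmxA !mxE big_ord1.
  rewrite [X in _ + delta_mx i0 0 a 0 * X](_ : _ =
     lam b - mu + ((mu - 1) *+ (i0 == b)) + y * (lam b - mu)); last first.
    rewrite mxE (eq_bigr (fun j => jp_row i0 0 j * (if (j < s'.+1)%N then 1 else mu) *+ (j == b)
        + jp_row i0 0 j * x j 0 * (lam b - mu))); last first.
      by move=> j _; rewrite [X in _ * X]mxE -s's mulrDr mulrnAr mulrA.
    rewrite big_split /= -mulr_suml -/y; congr (_ + _).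
    rewrite (bigD1 b) //= eqxx mulr1n big1 ?addr0 => [|j jb]; last first.
      by rewrite (negPf jb) mulr0n.
    have bi : (b == i0) = (b == s' :> nat) by rewrite -val_eqE.
    rewrite mxE ltnS [i0 == b]eq_sym bi /=.
    case: (ltngtP b s') => [bs|bs|bs] /=.
    - by rewrite mulr1 addr0.
    - by rewrite mulfVK // addr0.
    - have -> : b = i0 by apply: val_inj.
      by rewrite mulr1 mulr1n addrA subrK.
  rewrite mxE eqxx andbT -s's ltnS.
  have [->|ai] := eqVneq a i0.
    rewrite x0 -?s's // mul1r mul0r addr0 leqnn ltnn.
    by case: (i0 == b); rewrite ?mulr1n ?mulr0n; ring.
  rewrite mul0r addr0 leq_eqVlt; congr (_ *+ _ + _).
  by rewrite -(inj_eq val_inj) in ai; rewrite /= in ai; rewrite (negPf ai).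
have [x [_ Bx]] := key 0%N (leq0n _); exists x.
transitivity (\prod_(0 <= i < l.+1) B i).
  by rewrite big_mkord; apply: eq_bigr => i _; rewrite /B inord_val.
rewrite Bx; apply/matrixP=> a b; rewrite !mxE big_ord1 !mxE.
by [].
Qed.

(** The product is [mu] times the identity plus a rank one matrix, so one eigenvalue is left to
    find; the determinant, known from [prod_lam], forces it to be [eta]. *)
Lemma jp_conj : conjugate_mx (\prod_i refl i) (dseq (eta :: nseq l mu)).
Proof.
have [x Bx] := jp_prod; pose k : 'rV[F]_l.+1 := \row_j (lam j - mu).
have dB : \det (\prod_i refl i) = eta * mu ^+ l.
  rewrite (big_morph determinant (@det_mulmx _ _) (@det1 _ _)) -prod_lam.
  apply: eq_bigr => i _; rewrite (det_1D_mul (jp_rowE _ _)) mxE ltnn eqxx.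
  by rewrite addrC subrK.
have Bx' : \prod_i refl i = mu *: (1%:M + (mu^-1 *: x) *m k).
  by rewrite Bx scalerDr scalemx1 -scalemxAl scalerA mulfV // scale1r.
have kx : k *m (mu^-1 *: x) = (eta / mu - 1)%:M.
  rewrite [LHS]mx11_scalar; congr (_%:M).
  move: dB; rewrite Bx' detZ (det_1D_mul (mx11_scalar _)) exprS [mu * _]mulrC.
  rewrite -mulrA mulrC => /(mulIf (expf_neq0 l mu0)) <-.
  by rewrite [mu * _]mulrC mulfK // addrC addKr.
have em : eta / mu != 1 by rewrite -(inj_eq (mulIf mu0)) mulfVK // mul1r.
have := conj_scale mu (conj_rank_one kx em); rewrite -Bx' /= map_nseq mulr1.
by rewrite mulrC mulfVK.
Qed.

(** Since [Y *m X] is invertible, the space is the direct sum of the image of [X] and the kernel of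
    [Y]. A factorization of [1%:M + Y *m X] is carried to the first summand and extended by the
    identity on the second. *)
Lemma reflection_factorization d (X : 'M[F]_(d, l.+1)) (Y : 'M[F]_(l.+1, d)) :
  Y *m X \in unitmx -> conjugate_mx (1%:M + Y *m X) (dseq (eta :: nseq l mu)) ->
  exists (u : 'I_l.+1 -> 'cV[F]_d) (v : 'I_l.+1 -> 'rV[F]_d),
  [/\ 1%:M + X *m Y = \prod_i (1%:M + u i *m v i),
      forall i, v i *m u i = (lam i - 1)%:M
    & forall i j, i != j -> v i *m u j != 0].
Proof.
move=> uYX /conj_sym/(conj_trans jp_conj)[T [S [TS ST BT]]].
pose Z := invmx (Y *m X).
(* [phi B] acts as [B] on the image of [X], in the basis [X *m S], and trivially on the kernel of
   [Y]; [TZYXS] below makes it multiplicative. *)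
pose phi (B : 'M[F]_l.+1) : 'M[F]_d := 1%:M + X *m S *m (B - 1%:M) *m T *m Z *m Y.
have phi1 : phi 1%:M = 1%:M by rewrite /phi subrr mulmx0 !mul0mx addr0.
have TZYXS : T *m Z *m Y *m X *m S = 1%:M.
  by rewrite -(mulmxA _ Y) -(mulmxA T) mulVmx // mulmx1.
have phiM : {morph phi : A B / A *m B >-> A *m B}.
  move=> A B; rewrite /phi mulmxDl mul1mx mulmxDr mulmx1.
  set a := A - 1%:M; set b := B - 1%:M.
  have -> : X *m S *m a *m T *m Z *m Y *m (X *m S *m b *m T *m Z *m Y) =
      X *m S *m (a *m b) *m T *m Z *m Y.
    rewrite !mulmxA -(mulmxA (X *m S *m a)) -(mulmxA (X *m S *m a)).
    rewrite -(mulmxA (X *m S *m a)) -(mulmxA (X *m S *m a)).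
    by rewrite TZYXS mulmx1.
  have -> : A *m B - 1%:M = b + (a + a *m b).
    rewrite -[X in b + (X + _)]mulmx1 -mulmxDr [1%:M + b]addrC /b /a subrK.
    by rewrite mulmxBl mul1mx [RHS]addrC addrA subrK.
  by rewrite !(mulmxDr, mulmxDl) addrA.
exists (fun i => X *m S *m delta_mx i 0), (fun i => jp_row i *m T *m Z *m Y).
have vu i j : jp_row i *m T *m Z *m Y *m (X *m S *m delta_mx j 0) =
    jp_row i *m delta_mx j 0.
  by rewrite -[jp_row i in RHS]mulmx1 -TZYXS !mulmxA.
split=> [|i|i j ij]; last by rewrite vu jp_row_neq0.
- transitivity (phi (\prod_i refl i)).
    have TYXS : T *m (1%:M + Y *m X) *m S - 1%:M = T *m (Y *m X) *m S.
      by rewrite mulmxDr mulmx1 mulmxDl TS addrAC subrr add0r.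
    rewrite BT /phi TYXS !mulmxA -(mulmxA X S T) ST mulmx1.
    rewrite -(mulmxA _ S T) ST mulmx1 -(mulmxA X Y X) -(mulmxA X _ Z).
    by rewrite mulmxV // mulmx1.
  rewrite (big_morph phi phiM phi1); apply: eq_bigr => i _.
  by rewrite /phi /refl addrAC subrr add0r !mulmxA.
- by rewrite vu jp_rowE mxE ltnn eqxx.
Qed.
End JordanPochhammer.

(** * Invertible matrices and elementary properties of local systems *)

Section GeneralLinear.
Variables (F : fieldType) (d : nat).

(** [weval] takes values in a [groupType], so invertible matrices are packaged as one. *)
Definition gl : Type := {A : 'M[F]_d | A \in unitmx}.
HB.instance Definition _ := Choice.on gl.

Definition gl_one : gl := 
  exist (fun A : 'M[F]_d => A \in unitmx) 1%:M (unitmx1 F d).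
Definition gl_mul (A B : gl) : gl :=
  exist (fun A : 'M[F]_d => A \in unitmx) (val A *m val B)
    (etrans (unitmx_mul _ _) (introT andP (conj (valP A) (valP B)))).
Definition gl_inv (A : gl) : gl :=
  exist (fun A : 'M[F]_d => A \in unitmx) (invmx (val A)) (etrans (unitmx_inv _) (valP A)).

Lemma gl_mulA : associative gl_mul.
Proof. by move=> A B C; apply: val_inj; rewrite /= mulmxA. Qed.
Lemma gl_mul1 : left_id gl_one gl_mul.
Proof. by move=> A; apply: val_inj; rewrite /= mul1mx. Qed.
Lemma gl_1mul : right_id gl_one gl_mul.
Proof. by move=> A; apply: val_inj; rewrite /= mulmx1. Qed.
Lemma gl_mulV : left_inverse gl_one gl_inv gl_mul.
Proof. by move=> A; apply: val_inj; rewrite /= mulVmx ?(valP A). Qed.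
Lemma gl_Vmul : right_inverse gl_one gl_inv gl_mul.
Proof. by move=> A; apply: val_inj; rewrite /= mulmxV ?(valP A). Qed.

HB.instance Definition _ := isGroup.Build gl
  gl_mulA gl_mul1 gl_1mul gl_mulV gl_Vmul.

Lemma gl_valM (A B : gl) : val (A * B)%g = val A *m val B.
Proof. by []. Qed.

Lemma gl_val1 : val (1%g : gl) = 1%:M.
Proof. by []. Qed.

Lemma gl_valX (A : gl) n : val (A ^+ n)%g = val A ^+ n.
Proof. by elim: n => [|n IH] //; rewrite expgS exprS gl_valM IH. Qed.
End GeneralLinear.

Section LocalSystemTheory.
Variables (F : fieldType) (G : groupType) (L : local_system F G).

Lemma ls_mulV g : L g *m L g^-1%g = 1%:M.
Proof. by rewrite -ls_rhoM mulgV ls_rho1. Qed.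

Lemma ls_mulVl g : L g^-1%g *m L g = 1%:M.
Proof. by rewrite -ls_rhoM mulVg ls_rho1. Qed.

Lemma ls_unit g : L g \in unitmx.
Proof. exact: (mulmx1_unit (ls_mulV g)).1. Qed.

Lemma ls_exp g n : L (g ^+ n)%g = L g ^+ n.
Proof.
by elim: n => [|n IH]; rewrite ?ls_rho1 // expgS exprS ls_rhoM IH.
Qed.

Lemma ls_prod l (g : 'I_l -> G) : L (\prod_(i < l) g i)%g = \prod_(i < l) L (g i).
Proof. by rewrite (big_morph L (@ls_rhoM _ _ L) (@ls_rho1 _ _ L)). Qed.

Lemma ls_expz_scalar g c m : c != 0 -> L g = c%:M -> L (expgz g m) = (c ^ m)%:M.
Proof.
move=> c0 Lg.
have Ln n : L (g ^+ n)%g = (c ^+ n)%:M.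
  by rewrite ls_exp Lg; elim: n => [|n IH] //; rewrite !exprS IH scalar_mxM mulmxE.
case: m => n; first exact: Ln.
rewrite /= NegzE -[LHS]mulmx1 -(_ : (c ^+ n.+1)%:M *m (c ^- n.+1)%:M = 1%:M).
  rewrite mulmxA -{1}Ln ls_mulVl mul1mx.
  by rewrite -exprnN.
by rewrite -scalar_mxM mulfV // expf_neq0.
Qed.
End LocalSystemTheory.

(** Every element is the class of a word, so intertwining extends from generators by induction on
    words; the inverse case is uniqueness of inverses. *)
Lemma ls_iso_gens (F : fieldType) (X : Type) (R : wrel X)
    (L M : local_system F (presented R))
    (P : 'M_(ls_rank L, ls_rank M)) (Q : 'M_(ls_rank M, ls_rank L)) :
  P *m Q = 1%:M -> Q *m P = 1%:M ->
  (forall x, L (pres_gen R x) = P *m M (pres_gen R x) *m Q) -> ls_iso L M.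
Proof.
move=> PQ QP LM; exists P, Q; split=> // g.
rewrite (pres_piE g) -weval_pres_gen.
elim: (repr g) => [x||u IHu v IHv|u IHu] /=.
- exact: LM.
- by rewrite !ls_rho1 mulmx1.
- by rewrite !ls_rhoM IHu IHv !mulmxA -(mulmxA _ Q P) QP mulmx1.
- set h := weval _ u; have E : L h *m (P *m M h^-1%g *m Q) = 1%:M.
    rewrite IHu !mulmxA -(mulmxA _ Q P) QP mulmx1 -(mulmxA P (M _)) ls_mulV.
    by rewrite mulmx1.
  by rewrite -[LHS]mulmx1 -E mulmxA ls_mulVl mul1mx.
Qed.

(** * Local systems from matrices satisfying the relations *)

Section Existence.
Variable F : fieldType.

(** The map and its laws are returned unbundled, so that the local system built from them has rank
    [d] by definition. *)
Lemma presented_system (X : Type) (R : wrel X) d (m : X -> 'M[F]_d)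
    (mU : forall x, m x \in unitmx) :
  (forall u v, R u v ->
    val (weval (fun x => exist (fun A : 'M[F]_d => A \in unitmx) (m x) (mU x) : gl F d) u)
    = val (weval (fun x => exist (fun A : 'M[F]_d => A \in unitmx) (m x) (mU x) : gl F d) v)) ->
  exists (rho : presented R -> 'M[F]_d) (rho1 : rho 1%g = 1%:M)
    (rhoM : forall g h, rho (g * h)%g = rho g *m rho h),
    forall x, rho (pres_gen R x) = m x.
Proof.
pose f x : gl F d := exist (fun A : 'M[F]_d => A \in unitmx) (m x) (mU x).
rewrite -/f => fR.
have f_rel u v : R u v -> weval f u = weval f v by move=> /fR /val_inj.
pose rho (g : presented R) : 'M[F]_d := val (lift_fun f g).
have rho1 : rho 1%g = 1%:M by rewrite /rho (Defs.lift_fun1 f_rel).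
have rhoM g h : rho (g * h)%g = rho g *m rho h by rewrite /rho (lift_funM f_rel).
by exists rho, rho1, rhoM => x; rewrite /rho (lift_fun_gen f_rel).
Qed.

Lemma val_expgz d (A : gl F d) c m : c != 0 -> val A = c%:M ->
  val (expgz A m) = (c ^ m)%:M.
Proof.
move=> c0 Ac; have An n : val (A ^+ n)%g = (c ^+ n)%:M.
  by rewrite gl_valX Ac; elim: n => [|n IH] //; rewrite !exprS IH scalar_mxM mulmxE.
case: m => n; first exact: An.
by rewrite -[LHS]/(invmx (val (A ^+ n.+1)%g)) An invmx_scalar NegzE -exprnN.
Qed.

Section Turbine.
Variables (n l : nat) (s : int) (d : nat) (mA : 'I_l -> 'M[F]_d)
  (M N : 'M[F]_d) (eps : F).
Hypotheses (eps0 : eps != 0) (AU : forall i, mA i \in unitmx)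
  (MU : M \in unitmx) (NU : N \in unitmx)
  (MN : \prod_i mA i *m N = M) (Nn : N ^+ n = (eps ^ s)%:M).

Let mat (x : tgen l) : 'M[F]_d :=
  match x with
  | Alpha i => mA i | Omega0 => M | OmegaInf => N | Delta => eps%:M
  end.

Let matU x : mat x \in unitmx.
Proof. by case: x => [i||| ] //=; rewrite unitmxE det_scalar unitfE expf_neq0. Qed.

Let f x := exist (fun A : 'M[F]_d => A \in unitmx) (mat x) (matU x) : gl F d.

Let turbine_star_mat u v : turbine_star_rel u v ->
  val (weval f u) = val (weval f v).
Proof.
case=> [|x]; last by rewrite /= scalar_mxC.
rewrite /= weval_alpha_word (big_morph val (@gl_valM F d) (@gl_val1 F d)).
exact: MN.
Qed.

Let compl_star_mat u v : compl_star_rel n s u v ->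
  val (weval f u) = val (weval f v).
Proof.
case=> [/turbine_star_mat //|[-> ->]].
by rewrite weval_expn weval_expz gl_valX Nn (val_expgz _ eps0).
Qed.

Lemma compl_star_system :
  exists (rho : pi1_compl_star n l s -> 'M[F]_d) (rho1 : rho 1%g = 1%:M)
    (rhoM : forall g h, rho (g * h)%g = rho g *m rho h),
  [/\ forall i, rho (galpha _ i) = mA i, rho (gomega0 _) = M,
      rho (gomegaInf _) = N & rho (gdelta _) = eps%:M].
Proof.
have [rho [rho1 [rhoM rhoE]]] := presented_system compl_star_mat.
by exists rho, rho1, rhoM; split=> [i|||]; rewrite rhoE.
Qed.

Lemma compl_system k r : M ^+ k = (eps ^ r)%:M ->
  exists (rho : pi1_compl n k l r s -> 'M[F]_d) (rho1 : rho 1%g = 1%:M)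
    (rhoM : forall g h, rho (g * h)%g = rho g *m rho h),
  [/\ forall i, rho (galpha _ i) = mA i, rho (gomega0 _) = M,
      rho (gomegaInf _) = N & rho (gdelta _) = eps%:M].
Proof.
move=> Mk.
have compl_mat u v : compl_rel n k r s u v -> val (weval f u) = val (weval f v).
  case=> [[/turbine_star_mat //|[-> ->]]|[-> ->]];
  by rewrite weval_expn weval_expz gl_valX (val_expgz _ eps0) //= ?Mk ?Nn.
have [rho [rho1 [rhoM rhoE]]] := presented_system compl_mat.
by exists rho, rho1, rhoM; split=> [i|||]; rewrite rhoE.
Qed.
End Turbine.
End Existence.

(** * Katz rigidity for tuples of matrices *)

Section MatrixRigidity.
Variable F : numFieldType.
Implicit Types (e f : seq F).

(** By [rank_two_sided], a bound for the codimension of the fixed space on Hom of a local monodromy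
    with these two spectra. *)
Definition ndiff e f := (\sum_(x <- e) \sum_(y <- f) (x != y))%N.

Lemma conj_inv d (M : 'M[F]_d) e : conjugate_mx M (dseq e) -> 0 \notin e ->
  conjugate_mx (invmx M) (dseq [seq x^-1 | x <- e]).
Proof.
move=> cM e0; have uM := unit_conj cM e0.
have [P [Q [PQ QP eM]]] := cM.
pose D : 'M[F]_(size e) := diag_mx (\row_(i < size e) (e`_i)^-1).
have MD : M *m (P *m D *m Q) = 1%:M.
  have DD : dseq e *m D = 1%:M.
    rewrite mulmx_diag; apply/matrixP=> i j; rewrite !mxE mulfV //.
    by apply: contraNneq e0 => <-; rewrite mem_nth.
  by rewrite eM !mulmxA -(mulmxA _ Q P) QP mulmx1 -(mulmxA P) DD mulmx1.
have -> : invmx M = P *m D *m Q by rewrite -[RHS](mulKmx uM) MD mulmx1.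
have c1 : conjugate_mx (P *m D *m Q) D by exists P, Q.
apply: conj_trans c1 _; apply: conj_eq; first by rewrite size_map.
move=> i j i' j' ii jj; rewrite dseqE !mxE -2!(inj_eq val_inj) /= ii jj.
by rewrite (nth_map 0) // -ii.
Qed.

Lemma ndiff_simple (x : F) m : x != 1 ->
  ndiff (x :: nseq m 1) (x :: nseq m 1) = (m + m)%N.
Proof.
move=> x1; rewrite /ndiff big_cons big_nseq iter_addn_0 !big_cons !big_nseq.
by rewrite !iter_addn_0 !eqxx [1 == x]eq_sym x1 /=; lia.
Qed.

(** Scott's count gives an intertwiner, and Schur's lemma inverts it. The spectrum [e'] of [M'] may
    differ from [e], as the case without shaft requires. *)
Lemma matrix_rigid d' d l (A' : 'I_l -> 'M[F]_d') (M' N' : 'M[F]_d')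
    (u : 'I_l -> 'cV[F]_d) (v : 'I_l -> 'rV[F]_d) (M N : 'M[F]_d)
    (lam : 'I_l -> F) e' e f :
  d' = d ->
  M' = \prod_i A' i *m N' ->
  M = \prod_i (1%:M + u i *m v i) *m N ->
  (forall i, conjugate_mx (A' i) (dseq (lam i :: nseq d.-1 1))) ->
  (forall i, v i *m u i = (lam i - 1)%:M) ->
  (forall i, lam i != 0) -> (forall i, lam i != 1) ->
  (forall i j, i != j -> v i *m u j != 0) ->
  conjugate_mx M' (dseq e') -> conjugate_mx M (dseq e) ->
  conjugate_mx N' (dseq f) -> conjugate_mx N (dseq f) ->
  0 \notin e' -> 0 \notin e -> 0 \notin f ->
  (forall y, y \in e -> y \notin f) ->
  (l * (d.-1 + d.-1) + ndiff f f + ndiff e' e < d' * d + d' * d)%N ->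
  exists (P : 'M[F]_(d', d)) (Q : 'M[F]_(d, d')),
    [/\ P *m Q = 1%:M, Q *m P = 1%:M,
        forall i, A' i = P *m (1%:M + u i *m v i) *m Q,
        M' = P *m M *m Q & N' = P *m N *m Q].
Proof.
move=> dd eM' eM cA' vu lam0 lam1 uv cM' cM cN' cN e'0 e0 f0 ef lt.
pose A i := 1%:M + u i *m v i.
have cA i : conjugate_mx (A i) (dseq (lam i :: nseq d.-1 1)) by apply: conj_rank_one.
have l0 i : 0 \notin lam i :: nseq d.-1 1.
  rewrite inE negb_or eq_sym lam0 /=.
  by apply/negP => /nseqP[/esym/eqP]; rewrite oner_eq0.
have uA' i := unit_conj (cA' i) (l0 i).
have uM' := unit_conj cM' e'0; have uM := unit_conj cM e0.
have uN' := unit_conj cN' f0; have uN := unit_conj cN f0.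
(* The order is that of the relation N M^-1 A_1 ... A_l = 1. *)
pose gs := (N', N) :: (invmx M', invmx M) :: [seq (A' i, A i) | i <- index_enum 'I_l].
have prodE d0 (B : 'I_l -> 'M[F]_d0) (M0 N0 : 'M[F]_d0) : M0 = \prod_i B i *m N0 ->
    M0 \in unitmx -> N0 *m (invmx M0 *m \prod_i B i) = 1%:M.
  move=> eM0 uM0; rewrite mulmxA; apply: mulmx1C; rewrite mulmxA -eM0.
  by rewrite mulmxV.
have [||P [Q [PQ QP PQg]]] := @intertwiner_invertible F d' d gs dd.
- move=> U gU; apply: (irreducible_core cM cN ef eM uv).
  + move=> i x xU; apply: (gU (A' i, A i)) => //.
    by rewrite !inE (map_f (fun i => (A' i, A i))) ?orbT ?mem_index_enum.
  + have NU : forall x, x \in U -> N *m x \in U.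
      by move=> x; apply: (gU (N', N)); rewrite ?mem_head.
    move=> x xU; rewrite eM -mulmxA; have := NU x xU; move: (N *m x) => y.
    apply: (big_ind (fun B : 'M[F]_d => forall y : 'cV_d, y \in U -> B *m y \in U)).
    * by move=> z; rewrite mul1mx.
    * by move=> B C hB hC z zU; rewrite -mulmxE -mulmxA hB ?hC.
    * move=> i _ z; apply: (gU (A' i, A i)).
      by rewrite !inE (map_f (fun i => (A' i, A i))) ?orbT ?mem_index_enum.
  + by move=> x; apply: (gU (N', N)); rewrite ?mem_head.
- apply: intertwiner_exists.
  + move=> g; rewrite !inE => /or3P[/eqP-> //|/eqP->|/mapP[i _ ->]] //=.
    by rewrite unitmx_inv.
  + by rewrite /gs !big_cons big_map /= -!mulmxE prodE.
  + by rewrite /gs !big_cons big_map /= -!mulmxE prodE.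
  + have h1 := rank_two_sided cN' cN uN'.
    have h2 : (\rank (two_sided (invmx (invmx M')) (invmx M) - 1%:M)%R <= ndiff e' e)%N.
      have := rank_two_sided (conj_inv cM' e'0) (conj_inv cM e0).
      rewrite unitmx_inv => /(_ uM'); rewrite big_map /ndiff.
      under eq_bigr do rewrite big_map.
      by under eq_bigr do under eq_bigr do rewrite (inj_eq invr_inj).
    have h3 : (\sum_i \rank (two_sided (invmx (A' i)) (A i) - 1%:M)%R <=
        l * (d.-1 + d.-1))%N.
      rewrite (_ : (l * _)%N = \sum_(i < l) (d.-1 + d.-1))%N; last first.
        by rewrite sum_nat_const card_ord.
      apply: leq_sum => i _.
      apply: leq_trans (rank_two_sided (cA' i) (cA i) (uA' i)) _.
      by rewrite -/(ndiff _ _) ndiff_simple.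
    apply: leq_ltn_trans lt; rewrite /gs !big_cons big_map /=.
    apply: leq_trans (leq_add h1 (leq_add h2 h3)) _.
    by rewrite -/(ndiff f f) addnA addnC addnA.
have gA i : (A' i, A i) \in gs.
  by rewrite !inE (map_f (fun i => (A' i, A i))) ?orbT ?mem_index_enum.
exists P, Q; split=> // [i||]; first exact: (PQg _ (gA i)).
(* The tuple contains inverses, so the relation for [M] is recovered from that for [invmx M]. *)
- have := PQg (invmx M', invmx M); rewrite !inE eqxx orbT => /(_ isT) /= iM.
  have PMQ : P *m M *m Q *m invmx M' = 1%:M.
    rewrite iM !mulmxA -(mulmxA _ Q P) QP mulmx1 -(mulmxA P) mulmxV // mulmx1.
    exact: PQ.
  by rewrite -[LHS]mul1mx -PMQ mulmxKV.
- by apply: (PQg (N', N)); rewrite mem_head.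
Qed.
End MatrixRigidity.

(** * Generators in a generic line, restriction to the turbine and to tori *)

Section LineGenerators.
Variable F : numFieldType.
Implicit Types (e f : seq F).

Lemma conj_codim d m (M : 'M[F]_d) (N : 'M[F]_m) :
  conjugate_mx M N -> fixed_codim M = fixed_codim N.
Proof. by move=> cMN; rewrite !fixed_codimE; apply/conj_rankE/conj_sub_scalar. Qed.

Lemma codim_conj_simple d (M : 'M[F]_d) x m :
  conjugate_mx M (dseq (x :: nseq m 1)) -> x != 1 -> fixed_codim M = 1%N.
Proof. by move=> cM x1; rewrite fixed_codimE (rank_conj_simple cM). Qed.

Lemma memv_bigcap_seq (V : vectType F) (I : eqType) (gs : seq I)
    (U : I -> {vspace V}) x :
  x \in (\bigcap_(g <- gs) U g)%VS -> {in gs, forall g, x \in U g}.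
Proof.
elim: gs => [|g gs IH] //; rewrite big_cons memv_cap => /andP[xg /IH xgs] h.
by rewrite inE => /orP[/eqP ->|/xgs].
Qed.

(* The hypotheses say that [x] is fixed by the conjugates [M^j A M^-j] for
   [j < k]; since [M^k] acts on [x] as a scalar, [A] then fixes the whole
   [M]-orbit of [x], on which [M] and [N] therefore agree. *)
Lemma common_fixed_eq0 d k (A M N : 'M[F]_d) e f c (x : 'cV[F]_d) :
  (0 < k)%N -> conjugate_mx M (dseq e) -> conjugate_mx N (dseq f) ->
  (forall y, y \in e -> y \notin f) -> A \in unitmx -> M \in unitmx ->
  M = A *m N -> M ^+ k *m x = c *: x ->
  (forall j, (j < k)%N -> exists2 y, M ^+ j *m y = x & A *m y = y) -> x = 0.
Proof.
move=> k0 cM cN ef uA uM eM Mkx fixA.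
have Mx i : (i <= k)%N -> (0 < i)%N -> A *m (M ^+ i *m x) = M ^+ i *m x.
  move=> ik i0; have [|y My Ay] := fixA (k - i)%N; first by lia.
  have -> : M ^+ i *m x = c *: y.
    have uMj : M ^+ (k - i) \in unitmx.
      by elim: (k - i)%N => [|j IH]; rewrite ?unitmx1 // exprS -mulmxE unitmx_mul uM.
    apply: (can_inj (mulKmx uMj)); rewrite mulmxA mulmxE -exprD subnK //.
    by rewrite Mkx -scalemxAr My.
  by rewrite -scalemxAr Ay.
have AM i : A *m (M ^+ i *m x) = M ^+ i *m x.
  have [m] := ubnP i; elim: m i => // m IH i im.
  have [ik|ki] := leqP i k.
    have [i0|i0] := posnP i; last exact: Mx.
    by have [y] := fixA 0%N k0; rewrite i0 expr0 !mul1mx => ->.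
  rewrite -(subnK (ltnW ki)) exprD -mulmxE -mulmxA Mkx -!scalemxAr IH //.
  by lia.
apply: (coprime_eq0 cM cN ef); elim=> [|i IH]; first by rewrite !expr0.
rewrite [N ^+ _]exprS -mulmxE -mulmxA -IH; apply: (can_inj (mulKmx uA)).
by rewrite AM (mulmxA A N) -eM mulmxA mulmxE -exprS.
Qed.

Lemma ls_presentation (l : nat) (R : wrel (tgen l))
    (L : local_system F (presented R)) :
  (forall u v, turbine_star_rel u v -> R u v) ->
  L (gomega0 R) = \prod_i L (galpha R i) *m L (gomegaInf R).
Proof.
move=> sR; have := pres_gen_rel (sR _ _ (TS_omega l)).
rewrite /= weval_alpha_word => /(congr1 (ls_rho L)); rewrite ls_rhoM => <-.
by rewrite ls_prod.
Qed.

Section Lines.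
Variables (l k : nat) (R : wrel (tgen l)) (L : local_system F (presented R)).

Lemma mem_line_gens j i : (j < k)%N ->
  (gomega0 R ^+ j * galpha R i * gomega0 R ^- j)%g \in line_gens R k.
Proof.
move=> jk; apply/allpairsP; exists ((k.-1 - j)%N, i).
rewrite mem_iota mem_enum /=; split=> //; first by lia.
by have -> : (k.-1 - (k.-1 - j) = j)%N by lia.
Qed.

Lemma size_line_gens : size (line_gens R k) = (k * l)%N.
Proof. by rewrite size_allpairs size_iota size_enum_ord. Qed.

Lemma line_gens_codim c : (forall i, fixed_codim (L (galpha R i)) = c) ->
  {in line_gens R k, forall g, fixed_codim (L g) = c}.
Proof.
move=> cA g /allpairsP[[j i] [_ _ ->]] /=; rewrite -(cA i); apply: conj_codim.
exists (L (gomega0 R ^+ (k.-1 - j))%g), (L (gomega0 R ^- (k.-1 - j))%g).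
by rewrite ls_mulV ls_mulVl !ls_rhoM.
Qed.

(** If [x] is fixed by the conjugates of all alpha_i by omega_0^j, then omega_0^-j x is fixed by
    every alpha_i, hence by their product, to which [common_fixed_eq0] applies. *)
Lemma line_gens_fixed_eq0 e f c x : (0 < k)%N ->
  conjugate_mx (L (gomega0 R)) (dseq e) -> conjugate_mx (L (gomegaInf R)) (dseq f) ->
  (forall y, y \in e -> y \notin f) ->
  (forall u v, turbine_star_rel u v -> R u v) ->
  {in line_gens R k, forall g, x \in fixed_space (L g)} ->
  L (gomega0 R) ^+ k *m x = c *: x -> x = 0.
Proof.
move=> k0 cM cN ef sR xg Mkx.
have eM := ls_presentation L sR.
apply: (common_fixed_eq0 k0 cM cN ef _ _ eM Mkx); rewrite -?ls_prod ?ls_unit //.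
move=> j jk; exists (L (gomega0 R ^- j)%g *m x).
  by rewrite -ls_exp mulmxA ls_mulV mul1mx.
rewrite ls_prod; apply: (big_ind (fun B : 'M[F]_(ls_rank L) =>
  B *m (L (gomega0 R ^- j)%g *m x) = L (gomega0 R ^- j)%g *m x)).
- by rewrite mul1mx.
- by move=> B C hB hC; rewrite -mulmxE -mulmxA hC hB.
- move=> i _; have := xg _ (mem_line_gens i jk).
  rewrite fixed_spaceE !ls_rhoM => /eqP xj.
  by rewrite -{2}xj !mulmxA ls_mulVl mul1mx.
Qed.
End Lines.

Lemma ls_restrict_gen (X : Type) (R R' : wrel X) (sR : forall u v, R u v -> R' u v)
    (L : local_system F (presented R')) x :
  ls_restrict (pres_quot sR) L (pres_gen R x) = L (pres_gen R' x).
Proof. by congr (L _); apply: lift_fun_gen => u v h; apply: pres_gen_rel (sR u v h). Qed.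

(** Both presentations have the same generators, so an isomorphism after pull-back already
    intertwines the original systems. *)
Lemma ls_iso_restrict (X : Type) (R R' : wrel X) (sR : forall u v, R u v -> R' u v)
    (L L' : local_system F (presented R')) :
  ls_iso (ls_restrict (pres_quot sR) L') (ls_restrict (pres_quot sR) L) ->
  ls_iso L' L.
Proof.
move=> [P [Q [PQ QP LPQ]]]; apply: (@ls_iso_gens _ _ _ L' L P Q PQ QP) => x.
by have := LPQ (pres_gen R x); rewrite !ls_restrict_gen.
Qed.

Lemma ls_iso_torus (l : nat) (R : wrel (tgen l)) (x : tgen l)
    (sR : forall u v, turbine_star_rel u v -> R u v)
    (L L' : local_system F (presented R)) :
  ls_iso (ls_restrict (pres_lift (@torus_map_rel l R x sR)) L')
         (ls_restrict (pres_lift (@torus_map_rel l R x sR)) L) ->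
  conjugate_mx (L' (pres_gen R x)) (L (pres_gen R x)) /\
  conjugate_mx (L' (gdelta R)) (L (gdelta R)).
Proof.
move=> [P [Q [PQ QP LPQ]]]; split; exists P, Q; split=> //.
- have := LPQ (pres_gen _ TTrans).
  by rewrite /= !(lift_fun_gen (torus_map_rel x sR)).
- have := LPQ (pres_gen _ TDelta).
  by rewrite /= !(lift_fun_gen (torus_map_rel x sR)).
Qed.
End LineGenerators.

(** * Multiplicities and pairs of distinct eigenvalues *)

Section Counting.
Variable F : numFieldType.
Implicit Types (zs e f : seq F).

(** Common form of the spectra of omega_0 and omega_oo in the presence of the shaft. *)
Definition bshape l zs b : seq F := flatten [seq nseq l z | z <- zs] ++ [:: b].

Lemma size_bshape l zs b : size (bshape l zs b) = (size zs * l).+1.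
Proof.
rewrite size_cat size_flatten /shape -map_comp addn1; congr _.+1.
by elim: zs => //= z zs ->; rewrite size_nseq.
Qed.

Lemma mem_bshape l zs b x : x \in bshape l zs b -> x = b \/ x \in zs.
Proof.
rewrite mem_cat mem_seq1 => /orP[/flattenP[t /mapP[z zz ->]]|/eqP]; last by left.
by move=> /nseqP[-> _]; right.
Qed.

Lemma bshape_perm l zs zs' b : perm_eq zs zs' ->
  perm_eq (bshape l zs b) (bshape l zs' b).
Proof. by move=> zz; rewrite perm_cat2r; apply/perm_flatten/perm_map. Qed.

Lemma block_diagE (t : seq (F * nat)) :
  block_diag t = dseq (flatten [seq nseq x.2 x.1 | x <- t]).
Proof. by []. Qed.

(** Each entry of [e] equals exactly one entry of [zs], whatever its multiplicity in [e]. *)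
Lemma ndiff_uniq e zs : uniq zs -> {subset e <= zs} ->
  ndiff e zs = (size e * (size zs).-1)%N.
Proof.
move=> uz ez; rewrite /ndiff big_seq.
under eq_bigr => x /ez xz.
  have -> : (\sum_(y <- zs) (x != y) = (size zs).-1)%N.
    have : (\sum_(y <- zs) (x != y) + count_mem x zs = size zs)%N.
      elim: (zs) => [|z t IH]; rewrite ?big_nil // big_cons /= -IH eq_sym.
      by case: (z == x); rewrite /=; lia.
    by rewrite count_uniq_mem // xz; lia.
  over.
by rewrite -big_seq big_const_seq count_predT iter_addn_0 mulnC.
Qed.

Lemma sum_bshape l zs b (g : F -> nat) :
  (\sum_(x <- bshape l zs b) g x = l * \sum_(z <- zs) g z + g b)%N.
Proof.
rewrite big_cat big_seq1 big_flatten big_map big_distrr /=; congr (_ + _)%N.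
by apply: eq_bigr => z _; rewrite big_nseq iter_addn_0 mulnC.
Qed.

(** With k the size of [zs], pairs inside [zs] contribute l^2 k (k - 1), and [b] on either side
    contributes l k. *)
Lemma ndiff_bshape l zs b : uniq zs -> b \notin zs ->
  ndiff (bshape l zs b) (bshape l zs b) =
  (l * (l * (size zs * (size zs).-1)) + (l * size zs) + (l * size zs))%N.
Proof.
move=> uz bz; rewrite /ndiff sum_bshape.
under eq_bigr => x _ do rewrite sum_bshape.
rewrite sum_bshape eqxx addn0 big_split /= -big_distrr /= mulnDr.
rewrite -/(ndiff zs zs) ndiff_uniq //; congr (_ + _ * _ + _ * _)%N.
  rewrite big_seq (eq_bigr (fun=> 1%N)) => [|x xz].
    by rewrite -big_seq sum1_size.
  by case: eqP bz => // <-; rewrite xz.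
rewrite big_seq (eq_bigr (fun=> 1%N)) => [|x xz]; first by rewrite -big_seq sum1_size.
by rewrite eq_sym; case: eqP bz => // <-; rewrite xz.
Qed.

Lemma prod_subr_exp d (M : 'M[F]_d) k c zs :
  'X^k - c%:P = \prod_(z <- zs) ('X - z%:P) ->
  \prod_(z <- zs) (M - z%:M) = M ^+ k - c%:M.
Proof.
case: d M => [|d] M eX; first by apply/matrixP=> -[].
have := congr1 (horner_mx M) eX; rewrite rmorphB rmorphXn /= horner_mx_X horner_mx_C.
move=> ->; rewrite rmorph_prod; apply: eq_bigr => z _.
by rewrite rmorphB /= horner_mx_X horner_mx_C.
Qed.
End Counting.

(** * Roots of X^k - c *)

Section Roots.
Variables (F : numFieldType) (k : nat) (c : F) (zs : seq F).
Hypotheses (k0 : (0 < k)%N) (uzs : uniq zs)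
  (zsE : 'X^k - c%:P = \prod_(z <- zs) ('X - z%:P)).

Lemma size_roots : size zs = k.
Proof.
have := congr1 (fun p : {poly F} => size p) zsE.
by rewrite size_XnsubC // size_prod_XsubC => -[].
Qed.

Lemma mem_roots z : (z \in zs) = (z ^+ k == c).
Proof.
by rewrite -root_prod_XsubC -zsE rootE !hornerE subr_eq0.
Qed.

Lemma roots_ofP : roots_of k c zs.
Proof. by split=> // z; rewrite mem_roots. Qed.

Lemma roots_of_perm zs' : roots_of k c zs' -> perm_eq zs' zs.
Proof.
by case=> uz' mz'; apply: uniq_perm => // z; rewrite mz' mem_roots.
Qed.

Lemma prod_roots : \prod_(z <- zs) z = (-1) ^+ (k - 1) * c.
Proof.
have := congr1 (fun p : {poly F} => p.[0]) zsE.
rewrite !hornerE horner_prod expr0n (gtn_eqF k0) sub0r => eqc.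
have -> : \prod_(z <- zs) z = (-1) ^+ k * \prod_(z <- zs) ('X - z%:P).[0].
  rewrite -size_roots.
  elim: (zs) => [|z t IH]; first by rewrite !big_nil mulr1.
  by rewrite !big_cons hornerXsubC sub0r exprS IH /=; ring.
have -> : (-1) ^+ k = - (-1) ^+ (k - 1) :> F.
  by rewrite -[in LHS](subnK k0) addn1 exprS mulN1r.
by rewrite -eqc mulrNN.
Qed.
End Roots.

(** * The curves with shaft *)

Section Star.
Variables (F : numFieldType) (n k l : nat) (r s : int) (eps b : F)
  (lam : 'I_l -> F) (xi : 'I_k.+1 -> F) (zs : seq F).
Hypotheses (k0 : (0 < k)%N) (l0 : (0 < l)%N) (eps0 : eps != 0) (b0 : b != 0)
  (lam0 : forall i, lam i != 0) (lam1 : forall i, lam i != 1)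
  (xi0 : forall i, xi i != 0) (xiI : injective xi) (xib : forall i, xi i != b)
  (xik : forall i, xi i ^+ k != eps ^ r) (bk : b ^+ k != eps ^ r)
  (uzs : uniq zs) (zsE : 'X^k - (eps ^ r)%:P = \prod_(z <- zs) ('X - z%:P)).

Let ys := [seq front xi i | i <- enum 'I_k].
Let e := bshape l zs b.
Let f := bshape l ys (xi ord_max).

(** The multiplicities enter through an equation so that the section serves both [L] and, with l = 1
    and all multiplicities one, G. *)
Lemma spectrum_omegaInf (m : 'I_k.+1 -> nat) :
  (forall j, m j = if j == ord_max then 1%N else l) ->
  flatten [seq nseq x.2 x.1 | x <- [seq (xi j, m j) | j <- enum 'I_k.+1]] = f.
Proof.
move=> mE; rewrite enum_ordSr !map_rcons flatten_rcons /=.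
rewrite mE eqxx /f /bshape /ys -!map_comp; congr (flatten _ ++ _).
by apply: eq_map => i /=; rewrite mE /front -(inj_eq val_inj) /= ltn_eqF.
Qed.

Lemma spectrum_omega0 zs' :
  flatten [seq nseq x.2 x.1 | x <- rcons [seq (z, l) | z <- zs'] (b, 1%N)] =
  bshape l zs' b.
Proof. by rewrite map_rcons flatten_rcons -map_comp. Qed.

Let zs0 : 0 \notin zs.
Proof.
by rewrite (mem_roots zsE) expr0n gtn_eqF //= eq_sym expfz_neq0.
Qed.

Let e0 : 0 \notin e.
Proof.
apply/negP => /mem_bshape[/esym/eqP|]; first by rewrite (negPf b0).
by apply/negP.
Qed.

Let mem_f y : y \in f -> exists i, y = xi i.
Proof.
move=> /mem_bshape[->|/mapP[i _ ->]]; first by exists ord_max.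
by exists (widen_ord (leqnSn k) i).
Qed.

Let f0 : 0 \notin f.
Proof. by apply/negP => /mem_f[i /esym/eqP]; rewrite (negPf (xi0 i)). Qed.

Let ef y : y \in e -> y \notin f.
Proof.
move=> ye; apply/negP => /mem_f[i yi]; move: ye; rewrite yi => /mem_bshape[/eqP|].
  by rewrite (negPf (xib i)).
by rewrite (mem_roots zsE) (negPf (xik i)).
Qed.

Let szs : size zs = k. Proof. exact: size_roots zsE. Qed.
Let sys : size ys = k. Proof. by rewrite size_map size_enum_ord. Qed.

Variables (L : local_system F (pi1_compl_star n l s)).
Variables (u : 'I_l -> 'cV[F]_(ls_rank L)) (v : 'I_l -> 'rV[F]_(ls_rank L)).
Hypotheses (Ldelta : L (gdelta _) = eps%:M)
  (Lalpha : forall i, L (galpha _ i) = 1%:M + u i *m v i)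
  (vu : forall i, v i *m u i = (lam i - 1)%:M)
  (uv : forall i j, i != j -> v i *m u j != 0)
  (Lomega0 : conjugate_mx (L (gomega0 _)) (dseq e))
  (LomegaInf : conjugate_mx (L (gomegaInf _)) (dseq f)).

Let rankL : ls_rank L = (k * l).+1.
Proof. by rewrite (conj_size Lomega0) size_bshape szs. Qed.

Let pres : L (gomega0 _) = \prod_i (1%:M + u i *m v i) *m L (gomegaInf _).
Proof.
rewrite ls_presentation; last by move=> ? ?; left.
by congr (_ *m _); apply: eq_bigr => i _.
Qed.

Let Lalpha_conj i :
  conjugate_mx (L (galpha _ i)) (dseq (lam i :: nseq (k * l) 1)).
Proof.
have rk : (ls_rank L).-1 = (k * l)%N by rewrite rankL.
by have := conj_rank_one (vu i) (lam1 i); rewrite -Lalpha rk.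
Qed.

Lemma star_local_data m : (forall j, m j = if j == ord_max then 1%N else l) ->
  local_data_star k r eps b lam xi m L.
Proof.
move=> mE; split=> //.
- by move=> i; rewrite Lalpha; apply: pseudo_reflection_rank_one.
- exists zs; first exact: roots_ofP zsE.
  by rewrite block_diagE spectrum_omega0.
- by rewrite block_diagE spectrum_omegaInf.
Qed.

Lemma star_irreducible : ls_irreducible L.
Proof.
split=> [|U LU]; first by rewrite rankL.
apply: (irreducible_core Lomega0 LomegaInf ef pres uv) => [i x|x|x];
  rewrite -?Lalpha; exact: LU.
Qed.

(** Common core of rigidity and uniqueness: both reduce to a system on the turbine with the spectra
    of [L]. *)
Lemma star_iso (L' : local_system F (pi1_turbine_star l)) :
  L' (gdelta _) = eps%:M ->
  (forall i, conjugate_mx (L' (galpha _ i)) (dseq (lam i :: nseq (k * l) 1))) ->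
  conjugate_mx (L' (gomega0 _)) (dseq e) ->
  conjugate_mx (L' (gomegaInf _)) (dseq f) ->
  ls_iso L' (ls_restrict (turbine_star_incl n l s) L).
Proof.
move=> L'd L'a L'0 L'i.
have rankL' : ls_rank L' = ls_rank L by rewrite (conj_size L'0) (conj_size Lomega0).
have [||P [Q [PQ QP PQa PQ0 PQi]]] := @matrix_rigid F _ _ l
   (fun i => L' (galpha _ i)) _ (L' (gomegaInf _)) u v _ _ lam _ _ _ rankL'
   (ls_presentation L' (fun _ _ h => h)) pres _ vu lam0 lam1 uv L'0 Lomega0 L'i LomegaInf
   e0 e0 f0 ef.
- by move=> i; rewrite (_ : (ls_rank L).-1 = (k * l)%N) // rankL.
(* With d = k l + 1 the codimensions add up to 2 (k l)^2 + 4 k l = 2 (d^2 - 1). *)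
- rewrite rankL' rankL /=.
  rewrite !ndiff_bshape ?sys ?szs //.
  + by case: (k) k0 => // k' _; rewrite /=; lia.
  + by rewrite (mem_roots zsE) (negPf bk).
  + by rewrite map_inj_uniq ?enum_uniq // => i j /xiI /(congr1 val) /= /val_inj.
  + apply/negP => /mapP[i _ /xiI /(congr1 val) /= /eqP].
    by rewrite gtn_eqF.
apply: (@ls_iso_gens _ _ _ L' (ls_restrict (turbine_star_incl n l s) L) P Q PQ QP).
move=> x; rewrite ls_restrict_gen; case: x => [i|||].
- by have := PQa i; rewrite -Lalpha.
- exact: PQ0.
- exact: PQi.
- have -> : L' (pres_gen _ Delta) = eps%:M := L'd.
  have -> : L (pres_gen _ Delta) = eps%:M := Ldelta.
  by rewrite mul_mx_scalar -scalemxAl PQ scalemx1.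
Qed.

Lemma star_rigid : ls_rigid_star L.
Proof.
move=> L' L'L; have i0 : 'I_l by apply: Ordinal l0.
have key i := ls_iso_torus (L'L i).
have E x : ls_restrict (turbine_star_incl n l s) L (pres_gen _ x) = L (pres_gen _ x).
  exact: ls_restrict_gen.
apply: star_iso.
(* The matrix of delta in [L] is scalar, so conjugacy to it is equality. *)
- have [_] := key (SB0 l); rewrite /gdelta E => -[P [Q [PQ QP ->]]].
  by rewrite [L _]Ldelta mul_mx_scalar -scalemxAl PQ scalemx1.
- move=> i; have [cA _] := key (SB i); rewrite E in cA.
  exact: conj_trans cA (Lalpha_conj i).
- have [c _] := key (SB0 l); rewrite E in c; exact: conj_trans c Lomega0.
- have [c _] := key (SBinf l); rewrite E in c; exact: conj_trans c LomegaInf.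
Qed.

(** The isomorphism is found on the turbine and comes back by [ls_iso_restrict]; the root list in
    the local data of [L'] is a permutation of [zs]. *)
Lemma star_unique m L' : (forall j, m j = if j == ord_max then 1%N else l) ->
  local_data_star k r eps b lam xi m L' -> ls_iso L' L.
Proof.
move=> mE [_ L'd L'a [zs' rzs' L'0] L'i].
rewrite block_diagE spectrum_omegaInf // in L'i.
rewrite block_diagE spectrum_omega0 in L'0.
have {}L'0 : conjugate_mx (L' (gomega0 _)) (dseq e).
  apply: conj_trans L'0 (conj_perm (bshape_perm _ _ _)).
  exact: roots_of_perm zsE _ rzs'.
have rankL' : ls_rank L' = (k * l).+1 by rewrite (conj_size L'0) size_bshape szs.
apply: (@ls_iso_restrict _ _ _ _ (fun u v h => or_introl h) L L').
have E x : ls_restrict (turbine_star_incl n l s) L' (pres_gen _ x) = L' (pres_gen _ x).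
  exact: ls_restrict_gen.
apply: star_iso; rewrite ?/gdelta ?/gomega0 ?/gomegaInf ?E //.
move=> i; rewrite /galpha E.
have rk : (ls_rank L').-1 = (k * l)%N by rewrite rankL'.
by have := conj_pseudo_reflection (L'a i); rewrite rk.
Qed.

Let alpha0E : L (galpha0 _ k r) = eps ^ r *: L (gomega0 _ ^- k)%g.
Proof. by rewrite ls_rhoM (ls_expz_scalar _ eps0 Ldelta) mul_scalar_mx. Qed.

Let alpha0M : L (galpha0 _ k r) *m L (gomega0 _) ^+ k = (eps ^ r)%:M.
Proof. by rewrite alpha0E -scalemxAl -ls_exp ls_mulVl scalemx1. Qed.

Let Malpha0 : L (gomega0 _) ^+ k *m L (galpha0 _ k r) = (eps ^ r)%:M.
Proof. by rewrite alpha0E -scalemxAr -ls_exp ls_mulV scalemx1. Qed.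

(** Multiplying alpha_0 - 1 by the invertible omega_0^k gives, up to sign, omega_0^k - eps^r, whose
    only nonzero eigenvalue is b^k - eps^r, with multiplicity one. *)
Lemma star_alpha0_codim : fixed_codim (L (galpha0 _ k r)) = 1%N.
Proof.
have uM : row_free (L (gomega0 _) ^+ k) by rewrite row_free_unit -ls_exp ls_unit.
rewrite fixed_codimE -(mxrankMfree _ uM) mulmxBl alpha0M mul1mx -mxrank_opp opprB.
apply: (@rank_conj_simple _ _ _ (b ^+ k) _ (k * l)) bk.
apply: conj_trans (conj_exp k Lomega0) (conj_perm _).
rewrite /e /bshape map_cat /= cats1 perm_rcons perm_cons.
rewrite (_ : map _ _ = nseq (k * l) (eps ^ r)) //.
have -> : (k * l = size zs * l)%N by rewrite szs.
have : {in zs, forall z, z ^+ k = eps ^ r}.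
  by move=> z; rewrite (mem_roots zsE) => /eqP.
elim: (zs) => //= z t IH zt; rewrite map_cat IH => [|y yt]; last first.
  by rewrite zt // inE yt orbT.
by rewrite map_nseq zt ?mem_head // mulSn nseqD.
Qed.

Lemma star_multiplicity_one :
  multiplicity_one (line_star_gens (compl_star_rel n s) k r) L.
Proof.
move=> g; rewrite inE => /orP[/eqP ->|]; first exact: star_alpha0_codim.
by apply: line_gens_codim => i; apply: codim_conj_simple (Lalpha_conj i) _.
Qed.

Lemma star_pochhammer : pochhammer (line_star_gens (compl_star_rel n s) k r) L.
Proof.
split.
  rewrite big_seq (eq_bigr (fun=> 1%N)) => [|g]; last exact: star_multiplicity_one.
  by rewrite -big_seq sum1_size /= size_line_gens rankL.
apply/eqP; rewrite -subv0; apply/subvP=> x /memv_bigcap_seq xg.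
rewrite memv0; apply/eqP.
apply: (line_gens_fixed_eq0 (c := eps ^ r) k0 Lomega0 LomegaInf ef) => //.
- by left.
- by move=> g gg; apply: xg; rewrite inE gg orbT.
(* Being fixed by alpha_0 = delta^r omega_0^-k means that omega_0^k multiplies [x] by eps^r. *)
- have := xg _ (mem_head _ _); rewrite fixed_spaceE => /eqP {1}<-.
  by rewrite mulmxA Malpha0 mul_scalar_mx.
Qed.

Lemma star_rip1 : rip1_star k r L.
Proof.
by split; [exact: star_irreducible|exact: star_rigid|exact: star_pochhammer
  |exact: star_multiplicity_one].
Qed.
End Star.

(** * A single curve without shaft *)

Section NoShaft.
Variables (F : numFieldType) (n k : nat) (r s : int) (eps eta : F)
  (xi : 'I_k -> F) (zs : seq F).
Hypotheses (k0 : (0 < k)%N) (eps0 : eps != 0) (eta0 : eta != 0) (eta1 : eta != 1)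
  (xi0 : forall i, xi i != 0) (xiI : injective xi)
  (xik : forall i, xi i ^+ k != eps ^ r)
  (uzs : uniq zs) (zsE : 'X^k - (eps ^ r)%:P = \prod_(z <- zs) ('X - z%:P)).

Let ys := [seq xi i | i <- enum 'I_k].

Let zs0 : 0 \notin zs.
Proof. by rewrite (mem_roots zsE) expr0n gtn_eqF //= eq_sym expfz_neq0. Qed.

Let ys0 : 0 \notin ys.
Proof. by apply/mapP => -[i _ /esym/eqP]; rewrite (negPf (xi0 i)). Qed.

Let zy y : y \in zs -> y \notin ys.
Proof.
rewrite (mem_roots zsE) => /eqP yk; apply/mapP => -[i _ yi].
by have := xik i; rewrite -yi yk eqxx.
Qed.

Let szs : size zs = k. Proof. exact: size_roots zsE. Qed.
Let sys : size ys = k. Proof. by rewrite size_map size_enum_ord. Qed.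
Let uys : uniq ys. Proof. by rewrite map_inj_uniq ?enum_uniq. Qed.

Variables (L : local_system F (pi1_compl n k 1 r s)).
Variables (u : 'cV[F]_(ls_rank L)) (v : 'rV[F]_(ls_rank L)).
Hypotheses (Ldelta : L (gdelta _) = eps%:M)
  (Lalpha : L (galpha _ ord0) = 1%:M + u *m v)
  (vu : v *m u = (eta - 1)%:M)
  (Lomega0 : conjugate_mx (L (gomega0 _)) (dseq zs))
  (LomegaInf : conjugate_mx (L (gomegaInf _)) (dseq ys)).

Let rankL : ls_rank L = k.
Proof. by rewrite (conj_size Lomega0) szs. Qed.

Let pres : L (gomega0 _) = \prod_(i < 1) (1%:M + u *m v) *m L (gomegaInf _).
Proof.
rewrite ls_presentation; last by move=> ? ?; left; left.
by congr (_ *m _); apply: eq_bigr => i _; rewrite (ord1 i).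
Qed.

Let Lalpha_conj i : conjugate_mx (L (galpha _ i)) (dseq (eta :: nseq k.-1 1)).
Proof.
rewrite (ord1 i); have rk : (ls_rank L).-1 = k.-1 by rewrite rankL.
by have := conj_rank_one vu eta1; rewrite -Lalpha rk.
Qed.

Let uv (i j : 'I_1) : i != j -> v *m u != 0.
Proof. by rewrite (ord1 i) (ord1 j) eqxx. Qed.

Lemma spectrum_simple :
  flatten [seq nseq x.2 x.1 | x <- [seq (xi j, 1%N) | j <- enum 'I_k]] = ys.
Proof. by rewrite -map_comp /ys; elim: (enum _) => //= j t ->. Qed.

Lemma spectrum_roots zs' :
  flatten [seq nseq x.2 x.1 | x <- [seq (z : F, 1%N) | z <- zs']] = zs'.
Proof. by rewrite -map_comp; elim: zs' => //= z t ->. Qed.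

Lemma noshaft_local_data : local_data eps (fun=> eta) xi (fun=> 1%N) L.
Proof.
split=> //.
- by move=> i; rewrite (ord1 i) Lalpha; apply: pseudo_reflection_rank_one.
- exists zs; first exact: roots_ofP zsE.
  by rewrite block_diagE spectrum_roots.
- by rewrite block_diagE spectrum_simple.
Qed.

Lemma noshaft_irreducible : ls_irreducible L.
Proof.
split=> [|U LU]; first by rewrite rankL.
apply: (irreducible_core Lomega0 LomegaInf zy pres uv) => [i x|x|x];
  rewrite -?Lalpha; exact: LU.
Qed.

Lemma omega0_exp (R : wrel (tgen 1)) (L' : local_system F (presented R)) :
  (forall a b, turbine_rel k r a b -> R a b) -> L' (gdelta _) = eps%:M ->
  L' (gomega0 _) ^+ k = (eps ^ r)%:M.
Proof.
move=> sR L'd; have := pres_gen_rel (sR _ _ (or_intror (conj erefl erefl))).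
rewrite weval_expn weval_expz => /(congr1 (ls_rho L')).
by rewrite ls_exp (ls_expz_scalar _ eps0 L'd).
Qed.

(* The torus of the shaft is not part of the boundary; the relation
   [omega_0^k = delta^r] still makes [omega_0] diagonalizable with spectrum in
   [zs], and the multiplicities do not matter in the count because those of
   [L] are all equal to one. *)
Lemma noshaft_iso (L' : local_system F (pi1_turbine k 1 r)) :
  L' (gdelta _) = eps%:M ->
  (forall i, conjugate_mx (L' (galpha _ i)) (dseq (eta :: nseq k.-1 1))) ->
  conjugate_mx (L' (gomegaInf _)) (dseq ys) ->
  ls_iso L' (ls_restrict (turbine_incl n k 1 r s) L).
Proof.
move=> L'd L'a L'i.
have rankL' : ls_rank L' = ls_rank L by rewrite (conj_size L'i) (conj_size LomegaInf).
have [|e' e'zs L'0] := @conj_annihilated _ _ (L' (gomega0 _)) zs uzs.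
  by rewrite (prod_subr_exp _ zsE) (omega0_exp (fun _ _ h => h) L'd) subrr.
have e'0 : 0 \notin e' by apply: contra zs0; apply: e'zs.
have se' : size e' = k by rewrite -(conj_size L'0) rankL' rankL.
have [||P [Q [PQ QP PQa PQ0 PQi]]] := @matrix_rigid F _ _ 1
   (fun i => L' (galpha _ i)) _ (L' (gomegaInf _)) (fun=> u) (fun=> v) _ _
   (fun=> eta) _ _ _ rankL'
   (ls_presentation L' (fun _ _ h => or_introl h)) pres _ (fun=> vu) (fun=> eta0)
   (fun=> eta1) uv L'0 Lomega0 L'i LomegaInf e'0 zs0 ys0 zy.
- by move=> i; rewrite (_ : (ls_rank L).-1 = k.-1) // rankL.
(* Here d = k and the total is 2 (k - 1) + 2 k (k - 1) = 2 (k^2 - 1). *)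
- rewrite rankL' rankL /=.
  rewrite !ndiff_uniq ?sys ?szs ?se' //.
  by case: (k) k0 => // k' _; rewrite /=; lia.
apply: (@ls_iso_gens _ _ _ L' (ls_restrict (turbine_incl n k 1 r s) L) P Q PQ QP).
move=> x; rewrite ls_restrict_gen; case: x => [i|||].
- by have := PQa i; rewrite -Lalpha (ord1 i).
- exact: PQ0.
- exact: PQi.
- have -> : L' (pres_gen _ Delta) = eps%:M := L'd.
  have -> : L (pres_gen _ Delta) = eps%:M := Ldelta.
  by rewrite mul_mx_scalar -scalemxAl PQ scalemx1.
Qed.

Lemma noshaft_rigid : ls_rigid L.
Proof.
move=> L' L'L.
have key i := ls_iso_torus (L'L i).
have E x : ls_restrict (turbine_incl n k 1 r s) L (pres_gen _ x) = L (pres_gen _ x).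
  exact: ls_restrict_gen.
apply: noshaft_iso.
- have [_] := key (NBinf 1); rewrite /gdelta E => -[P [Q [PQ QP ->]]].
  by rewrite [L _]Ldelta mul_mx_scalar -scalemxAl PQ scalemx1.
- move=> i; have [cA _] := key (NB i); rewrite E in cA.
  exact: conj_trans cA (Lalpha_conj i).
- have [c _] := key (NBinf 1); rewrite E in c; exact: conj_trans c LomegaInf.
Qed.

Lemma noshaft_unique L' : local_data eps (fun=> eta) xi (fun=> 1%N) L' ->
  ls_iso L' L.
Proof.
move=> [_ L'd L'a _ L'i]; rewrite block_diagE spectrum_simple in L'i.
have rankL' : ls_rank L' = k by rewrite (conj_size L'i) sys.
apply: (@ls_iso_restrict _ _ _ _ (fun u v h => or_introl h) L L').
have E x : ls_restrict (turbine_incl n k 1 r s) L' (pres_gen _ x) = L' (pres_gen _ x).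
  exact: ls_restrict_gen.
apply: noshaft_iso; rewrite ?/gdelta ?/gomegaInf ?E //.
move=> i; rewrite /galpha E; have rk : (ls_rank L').-1 = k.-1 by rewrite rankL'.
by have := conj_pseudo_reflection (L'a i); rewrite rk.
Qed.

Lemma noshaft_multiplicity_one :
  multiplicity_one (line_gens (compl_rel n k r s) k) L.
Proof.
by apply: line_gens_codim => i; apply: codim_conj_simple (Lalpha_conj i) _.
Qed.

Lemma noshaft_pochhammer : pochhammer (line_gens (compl_rel n k r s) k) L.
Proof.
split.
  rewrite big_seq (eq_bigr (fun=> 1%N)) => [|g]; last exact: noshaft_multiplicity_one.
  by rewrite -big_seq sum1_size size_line_gens rankL muln1.
apply/eqP; rewrite -subv0; apply/subvP=> x /memv_bigcap_seq xg.
rewrite memv0; apply/eqP.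
apply: (line_gens_fixed_eq0 (c := eps ^ r) k0 Lomega0 LomegaInf zy) => //.
- by move=> a b h; left; left.
(* The relation omega_0^k = delta^r takes the place of the condition at alpha_0. *)
- by rewrite (omega0_exp (fun _ _ h => or_introl h) Ldelta) mul_scalar_mx.
Qed.

Lemma noshaft_rip1 : rip1 L.
Proof.
by split; [exact: noshaft_irreducible|exact: noshaft_rigid
  |exact: noshaft_pochhammer|exact: noshaft_multiplicity_one].
Qed.
End NoShaft.

(** A root of X^k - c is nonzero, so the derivative k X^(k-1) does not vanish there and the root is
    simple. *)
Lemma separated_roots (F : numClosedFieldType) k (c : F) : (0 < k)%N -> c != 0 ->
  exists2 zs, uniq zs & 'X^k - c%:P = \prod_(z <- zs) ('X - z%:P).
Proof.
move=> k0 c0; have [zs zsE] := closed_field_poly_normal ('X^k - c%:P : {poly F}).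
have eX : 'X^k - c%:P = \prod_(z <- zs) ('X - z%:P).
  by rewrite [LHS]zsE (monicP (monicXnsubC c k0)) scale1r.
exists zs => //; rewrite -separable_prod_XsubC -eX separable_poly.unlock.
apply: Pdiv.ClosedField.root_coprimep => x.
rewrite rootE !hornerE subr_eq0 => /eqP xk.
rewrite derivB derivC subr0 derivXn hornerMn hornerXn -mulr_natr mulf_neq0 //.
  rewrite expf_neq0 //; apply: contraNneq c0 => x0.
  by rewrite -xk x0 expr0n gtn_eqF.
by rewrite pnatr_eq0 -lt0n.
Qed.

(** * Construction of F, G and L *)

Section Construction.
Variable F : numFieldType.
Implicit Types (zs e f : seq F).

Lemma bshape1 zs (b : F) : bshape 1 zs b = zs ++ [:: b].
Proof. by rewrite /bshape; elim: zs => //= z t ->. Qed.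

Lemma perm_flatten_nseqS m zs :
  perm_eq (zs ++ flatten [seq nseq m z | z <- zs])
          (flatten [seq nseq m.+1 z | z <- zs]).
Proof.
elim: zs => //= z t IH; rewrite perm_cons perm_catCA perm_cat2l.
exact: IH.
Qed.

Lemma conj_scalar_nseq m (c : F) : conjugate_mx (c%:M : 'M_m) (dseq (nseq m c)).
Proof.
apply: conj_eq => [|i j i' j' ii jj]; first by rewrite size_nseq.
by rewrite dseqE mxE -!val_eqE /= -ii -jj nth_nseq ltn_ord.
Qed.

(** The copies of [u] and [v] are assembled block diagonally into [X] and [Y], which keeps [Y *m X]
    scalar. *)
Lemma dsum_pow_data (R : wrel (tgen 1)) (L : local_system F (presented R))
    (u : 'cV_(ls_rank L)) (v : 'rV_(ls_rank L)) eps eta zs ys m :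
  L (galpha R ord0) = 1%:M + u *m v -> v *m u = (eta - 1)%:M ->
  L (gdelta R) = eps%:M ->
  conjugate_mx (L (gomega0 R)) (dseq zs) ->
  conjugate_mx (L (gomegaInf R)) (dseq ys) ->
  let D := dsum_pow L m in
  [/\ exists (X : 'M_(ls_rank D, m)) (Y : 'M_(m, ls_rank D)),
        D (galpha R ord0) = 1%:M + X *m Y /\ Y *m X = (eta - 1)%:M,
      D (gdelta R) = eps%:M,
      conjugate_mx (D (gomega0 R)) (dseq (flatten [seq nseq m z | z <- zs]))
    & conjugate_mx (D (gomegaInf R)) (dseq (flatten [seq nseq m z | z <- ys]))].
Proof.
move=> La vu Ld L0 Li /=.
have flat0 (t : seq F) : flatten [seq nseq 0 z | z <- t] = [::] by elim: t.
elim: m => [|m [[X [Y [Da YX]]] Dd D0 Di]] /=.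
  rewrite !flat0; split.
  - by exists 0, 0; split; apply/matrixP=> -[].
  - by apply/matrixP=> -[].
  - by apply: conj_eq => // -[].
  - by apply: conj_eq => // -[].
split.
- pose X' : 'M_(_, 1 + m) := block_mx u 0 0 X.
  pose Y' : 'M_(1 + m, _) := block_mx v 0 0 Y.
  have XY' : dsum_rho L (dsum_pow L m) (galpha R ord0) = 1%:M + X' *m Y'.
    rewrite mulmx_block !mulmx0 !mul0mx !addr0 !add0r /dsum_rho La Da.
    by rewrite [in RHS]scalar_mx_block add_block_mx !addr0.
  have YX' : Y' *m X' = (eta - 1)%:M.
    by rewrite mulmx_block !mulmx0 !mul0mx !addr0 !add0r YX vu -scalar_mx_block.
  by exists X', Y'.
- by rewrite /dsum_rho Ld Dd -scalar_mx_block.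
- apply: conj_trans (conj_block L0 D0) _.
  apply: conj_trans (conj_sym (conj_cat _ _)) (conj_perm _).
  exact: perm_flatten_nseqS.
- apply: conj_trans (conj_block Li Di) _.
  apply: conj_trans (conj_sym (conj_cat _ _)) (conj_perm _).
  exact: perm_flatten_nseqS.
Qed.

Lemma conj_dsum_bshape (G : groupType) (D E : local_system F G) g m zs b :
  conjugate_mx (D g) (dseq (flatten [seq nseq m z | z <- zs])) ->
  conjugate_mx (E g) (dseq (bshape 1 zs b)) ->
  conjugate_mx (dsum D E g) (dseq (bshape m.+1 zs b)).
Proof.
move=> Dg Eg; apply: conj_trans (conj_block Dg Eg) _.
apply: conj_trans (conj_sym (conj_cat _ _)) (conj_perm _).
rewrite bshape1 catA perm_cat2r perm_catC; exact: perm_flatten_nseqS.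
Qed.

(** The blocks are placed antidiagonally, so that the single eigenvalue of the last summand comes
    first in the small space, in the order expected by [reflection_factorization]. *)
Lemma dsum_alpha d d' m (X : 'M[F]_(d, m)) (Y : 'M[F]_(m, d)) (u : 'cV[F]_d')
    (v : 'rV[F]_d') mu eta : mu != 1 -> eta != 1 ->
  Y *m X = (mu - 1)%:M -> v *m u = (eta - 1)%:M ->
  exists (X' : 'M[F]_(d + d', m.+1)) (Y' : 'M[F]_(m.+1, d + d')),
  [/\ block_mx (1%:M + X *m Y) 0 0 (1%:M + u *m v) = 1%:M + X' *m Y',
      Y' *m X' \in unitmx
    & conjugate_mx (1%:M + Y' *m X') (dseq (eta :: nseq m mu))].
Proof.
move=> mu1 eta1 YX vu.
pose X' : 'M[F]_(d + d', 1 + m) := block_mx 0 X u 0.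
pose Y' : 'M[F]_(1 + m, d + d') := block_mx 0 v Y 0.
have YX' : Y' *m X' = block_mx (eta - 1)%:M 0 0 (mu - 1)%:M.
  by rewrite mulmx_block !mulmx0 !mul0mx !addr0 !add0r vu YX.
have XY' : block_mx (1%:M + X *m Y) 0 0 (1%:M + u *m v) = 1%:M + X' *m Y'.
  rewrite mulmx_block !mulmx0 !mul0mx !addr0 !add0r [in RHS]scalar_mx_block.
  by rewrite add_block_mx !addr0.
have uYX : Y' *m X' \in unitmx.
  rewrite YX' unitmxE det_ublock !det_scalar unitfE mulf_neq0 // expf_neq0 //;
  by rewrite subr_eq0.
have cYX : conjugate_mx (1%:M + Y' *m X') (dseq (eta :: nseq m mu)).
  rewrite YX' [X in X + _]scalar_mx_block add_block_mx !addr0 -!raddfD /=.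
  rewrite ![1 + _]addrC !subrK.
  apply: conj_trans (conj_block (conj_scalar_nseq 1 eta) (conj_scalar_nseq m mu)) _.
  exact: conj_sym (conj_cat _ _).
by exists X', Y'.
Qed.

Lemma exp_conj_scalar d (M : 'M[F]_d) e n c : conjugate_mx M (dseq e) ->
  {in e, forall x, x ^+ n = c} -> M ^+ n = c%:M.
Proof.
move=> /(conj_exp n) cM ec; apply: (conj_scalar cM) => x /mapP[y ye ->].
exact: ec.
Qed.

Section Main.
Variables (n k m : nat) (r s : int) (eps b : F) (lam : 'I_m.+1 -> F)
  (xi : 'I_k.+2 -> F) (eta1 eta2 : F) (zs : seq F).
Hypotheses (eps0 : eps != 0) (b0 : b != 0) (lam0 : forall i, lam i != 0)
  (xi0 : forall i, xi i != 0)
  (eta1E : eta1 = (-1) ^+ k * eps ^ r * \prod_(i < k.+1) (front xi i)^-1)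
  (eta2E : eta2 = (-1) ^+ k * eps ^ r * b * \prod_(i < k.+2) (xi i)^-1)
  (lam1 : forall i, lam i != 1) (eta1_1 : eta1 != 1) (eta2_1 : eta2 != 1)
  (lam_eta1 : forall i, lam i != eta1) (xiI : injective xi)
  (xib : forall i, xi i != b) (xik : forall i, xi i ^+ k.+1 != eps ^ r)
  (bk : b ^+ k.+1 != eps ^ r) (eta12 : eta1 != eta2)
  (det_rel : \prod_i lam i = eta2 * eta1 ^+ m)
  (xin : forall i, xi i ^+ n = eps ^ s)
  (uzs : uniq zs) (zsE : 'X^(k.+1) - (eps ^ r)%:P = \prod_(z <- zs) ('X - z%:P)).

Let frontI : injective (front xi).
Proof. by move=> i j /xiI /(congr1 val) /= /val_inj. Qed.

Let ys := [seq front xi i | i <- enum 'I_k.+1].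

Let uys : uniq ys.
Proof. by rewrite map_inj_uniq ?enum_uniq. Qed.

Let sys : size ys = k.+1.
Proof. by rewrite size_map size_enum_ord. Qed.

Let ys_last : xi ord_max \notin ys.
Proof.
by apply/mapP => -[i _ /xiI /(congr1 val) /= /eqP]; rewrite gtn_eqF.
Qed.

Let prod_ys : \prod_(x <- ys) x = \prod_i front xi i.
Proof. by rewrite /ys big_map big_enum. Qed.

Let mem_inf y : y \in ys ++ [:: xi ord_max] -> exists i, y = xi i.
Proof.
rewrite mem_cat mem_seq1 => /orP[/mapP[i _ ->]|/eqP ->]; last by exists ord_max.
by exists (widen_ord (leqnSn k.+1) i).
Qed.

(** [L] receives the matrices of omega_0, omega_oo and delta in the direct sum [D], while that of
    the fat meridian is factored by [reflection_factorization] with mu = eta1 and eta = eta2;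
    [det_rel] is its determinant condition. *)
Lemma main_existence :
  exists L : local_system F (pi1_compl_star n m.+1 s),
    [/\ rip1_star k.+1 r L,
        local_data_star k.+1 r eps b lam xi
          (fun j => if j == ord_max then 1%N else m.+1) L
      & exists (FL : local_system F (pi1_compl n k.+1 1 r s))
               (GL : local_system F (pi1_compl_star n 1 s)),
        [/\ rip1 FL,
            unique_up_to_iso
              (local_data eps (fun=> eta1) (front xi) (fun=> 1%N)) FL,
            rip1_star k.+1 r GL,
            unique_up_to_iso
              (local_data_star k.+1 r eps b (fun=> eta2) xi (fun=> 1%N)) GL
          & ls_iso (ls_restrict (fat_incl n m.+1 s) L)
                   (dsum (dsum_pow (ls_restrict (fill_shaft n k.+1 1 r s) FL) m)
                         GL)]].
Proof.
have szs : size zs = k.+1 by exact: size_roots zsE.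
have zs0 : 0 \notin zs by rewrite (mem_roots zsE) expr0n /= eq_sym expfz_neq0.
have pzs := prod_roots (ltn0Sn k) zsE; rewrite subSS subn0 in pzs.
have bzs : b \notin zs by rewrite (mem_roots zsE) (negPf bk).
have ys0 : 0 \notin ys.
  by apply/negP => h; have [|i /esym/eqP] := mem_inf (y := 0);
    rewrite ?mem_cat ?h // (negPf (xi0 i)).
have eta1_0 : eta1 != 0.
  rewrite eta1E !mulf_neq0 ?expf_neq0 ?oppr_eq0 ?oner_eq0 ?expfz_neq0 //.
  by apply/prodf_neq0 => i _; rewrite invr_eq0 xi0.
have eta2_0 : eta2 != 0.
  rewrite eta2E !mulf_neq0 ?expf_neq0 ?oppr_eq0 ?oner_eq0 ?expfz_neq0 //.
  by apply/prodf_neq0 => i _; rewrite invr_eq0 xi0.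
(* Matrices of F: omega_0 has the roots of eps^r as eigenvalues, omega_oo the first xi; [eta1] is
   the quotient of the determinants. *)
have [MF [NF [uF [vF [cMF cNF MNF vuF]]]]] :=
  hypergeometric_exists szs sys uzs uys ys0.
have eF : \prod_(x <- zs) x / \prod_(x <- ys) x = eta1.
  by rewrite pzs prod_ys eta1E prodfV.
rewrite eF in vuF.
have uMF := unit_conj cMF zs0; have uNF := unit_conj cNF ys0.
(* Both matrices are diagonalizable, so the relations with powers of delta are checked on
   eigenvalues. *)
have NFn : NF ^+ n = (eps ^ s)%:M.
  by apply: (exp_conj_scalar cNF) => x /mapP[i _ ->]; apply: xin.
have MFk : MF ^+ k.+1 = (eps ^ r)%:M.
  by apply: (exp_conj_scalar cMF) => x; rewrite (mem_roots zsE) => /eqP.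
have cAF := conj_rank_one vuF eta1_1.
have lamU d (c : F) (A : 'M[F]_d) p : c != 0 -> conjugate_mx A (dseq (c :: nseq p 1)) ->
    A \in unitmx.
  move=> c0 cA; apply: (unit_conj cA); rewrite inE negb_or eq_sym c0 /=.
  by apply/negP => /nseqP[/esym/eqP]; rewrite oner_eq0.
have prodF : \prod_(i < 1) (1%:M + uF *m vF) *m NF = MF by rewrite big_ord1.
have [rhoF [rhoF1 [rhoFM [Fa F0 Fi Fd]]]] := @compl_system F n 1 s _
  (fun=> 1%:M + uF *m vF) MF NF eps eps0 (fun=> lamU _ _ _ _ eta1_0 cAF) uMF uNF
  prodF NFn _ _ MFk.
pose FL := LocalSystem rhoF1 rhoFM.
have sG0 : size (bshape 1 zs b) = k.+2 by rewrite size_bshape szs muln1.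
have sGi : size (bshape 1 ys (xi ord_max)) = k.+2 by rewrite size_bshape sys muln1.
have uG0 : uniq (bshape 1 zs b).
  by rewrite bshape1 cats1 rcons_uniq bzs.
have uGi : uniq (bshape 1 ys (xi ord_max)).
  by rewrite bshape1 cats1 rcons_uniq ys_last.
have z0 l : 0 \notin bshape l zs b.
  by apply/negP => /mem_bshape[/esym/eqP|]; [rewrite (negPf b0)|apply/negP].
have y0 l : 0 \notin bshape l ys (xi ord_max).
  by apply/negP => /mem_bshape[/esym/eqP|]; [rewrite (negPf (xi0 _))|apply/negP].
(* Matrices of G: the extra eigenvalues [b] and the last xi change the quotient of determinants to
   [eta2]. *)
have [MG [NG [uG [vG [cMG cNG MNG vuG]]]]] :=
  hypergeometric_exists sG0 sGi uG0 uGi (y0 1%N).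
have eG : \prod_(x <- bshape 1 zs b) x / \prod_(x <- bshape 1 ys (xi ord_max)) x = eta2.
  rewrite !bshape1 !big_cat !big_seq1 /= pzs prod_ys eta2E prodfV.
  by rewrite [in RHS]big_ord_recr.
rewrite eG in vuG.
have uMG := unit_conj cMG (z0 _); have uNG := unit_conj cNG (y0 _).
have y_n l x : x \in bshape l ys (xi ord_max) -> x ^+ n = eps ^ s.
  by move=> /mem_bshape[->//|/mapP[i _ ->]]; apply: xin.
have NGn : NG ^+ n = (eps ^ s)%:M by apply: (exp_conj_scalar cNG) (y_n _).
have cAG := conj_rank_one vuG eta2_1.
have prodG : \prod_(i < 1) (1%:M + uG *m vG) *m NG = MG by rewrite big_ord1.
have [rhoG [rhoG1 [rhoGM [Ga G0 Gi Gd]]]] := @compl_star_system F n 1 s _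
  (fun=> 1%:M + uG *m vG) MG NG eps eps0 (fun=> lamU _ _ _ _ eta2_0 cAG) uMG uNG
  prodG NGn.
pose GL := LocalSystem rhoG1 rhoGM.
pose FF := ls_restrict (fill_shaft n k.+1 1 r s) FL.
have FFE x : FF (pres_gen _ x) = FL (pres_gen _ x) by exact: ls_restrict_gen.
have [[X [Y [Da YX]]] Dd D0 Di] := @dsum_pow_data _ FF uF vF eps eta1 zs ys m
  (etrans (FFE _) (Fa _)) vuF (etrans (FFE _) Fd)
  (eq_ind_r (fun A => conjugate_mx A _) (eq_ind_r (fun A => conjugate_mx A _) cMF F0) (FFE Omega0))
  (eq_ind_r (fun A => conjugate_mx A _) (eq_ind_r (fun A => conjugate_mx A _) cNF Fi) (FFE OmegaInf)).
pose D := dsum (dsum_pow FF m) GL.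
have [X' [Y' [DXY uYX cYX]]] := dsum_alpha eta1_1 eta2_1 YX vuG.
have eta21 : eta2 != eta1 by rewrite eq_sym.
have [u [v [uvE vu uv]]] := reflection_factorization eta1_0 lam_eta1
  eta21 det_rel uYX cYX.
have Dalpha : D (galpha _ ord0) = \prod_i (1%:M + u i *m v i).
  by rewrite -uvE -DXY -(Ga ord0) -Da.
have cM : conjugate_mx (D (gomega0 _)) (dseq (bshape m.+1 zs b)).
  by apply: conj_dsum_bshape D0 _; rewrite /= G0.
have cN : conjugate_mx (D (gomegaInf _)) (dseq (bshape m.+1 ys (xi ord_max))).
  by apply: conj_dsum_bshape Di _; rewrite /= Gi.
have Ddelta : D (gdelta _) = eps%:M.
  by rewrite [LHS]/(dsum_rho _ _ _) /dsum_rho Dd [GL _]Gd -scalar_mx_block.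
(* The turbine relation of [D], with the fat meridian factored, is the one required of [L]. *)
have MN : \prod_i (1%:M + u i *m v i) *m D (gomegaInf _) = D (gomega0 _).
  rewrite -Dalpha [RHS]ls_presentation; last by left.
  by rewrite big_ord1.
have [rho [rho1 [rhoM [La L0 Li Ld]]]] := @compl_star_system F n m.+1 s _
  (fun i => 1%:M + u i *m v i) _ _ eps eps0
  (fun i => lamU _ _ _ _ (lam0 i) (conj_rank_one (vu i) (lam1 i)))
  (ls_unit D _) (ls_unit D _) MN (exp_conj_scalar cN (y_n _)).
pose L := LocalSystem rho1 rhoM.
have L0' : conjugate_mx (L (gomega0 _)) (dseq (bshape m.+1 zs b)) by rewrite /= L0.
have Li' : conjugate_mx (L (gomegaInf _)) (dseq (bshape m.+1 ys (xi ord_max))).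
  by rewrite /= Li.
have GL0 : conjugate_mx (GL (gomega0 _)) (dseq (bshape 1 zs b)) by rewrite /= G0.
have GLi : conjugate_mx (GL (gomegaInf _)) (dseq (bshape 1 ys (xi ord_max))).
  by rewrite /= Gi.
have FL0 : conjugate_mx (FL (gomega0 _)) (dseq zs) by rewrite /= F0.
have FLi : conjugate_mx (FL (gomegaInf _)) (dseq ys) by rewrite /= Fi.
have uvG (i j : 'I_1) : i != j -> vG *m uG != 0 by rewrite (ord1 i) (ord1 j) eqxx.
have one_mult j : 1%N = if j == ord_max :> 'I_k.+2 then 1%N else 1%N by rewrite if_same.
exists L; split.
- exact: (star_rip1 (L := L) (ltn0Sn k) (ltn0Sn m) eps0 b0 lam0 lam1 xi0 xiI xib xik bk
    uzs zsE Ld La vu uv L0' Li').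
- exact: (star_local_data (L := L) lam0 lam1 xiI uzs zsE Ld La vu L0' Li'
    (fun=> erefl)).
exists FL, GL; split.
- exact: (noshaft_rip1 (L := FL) (ltn0Sn k) eps0 eta1_0 eta1_1 (fun i => xi0 _) frontI
    (fun i => xik _) uzs zsE Fd (Fa _) vuF FL0 FLi).
- split.
    exact: (noshaft_local_data (L := FL) eta1_0 eta1_1 frontI uzs zsE Fd (Fa _) vuF
      FL0 FLi).
  by move=> L' /(noshaft_unique (L := FL) (ltn0Sn k) eps0 eta1_0 eta1_1 (fun i => xi0 _) frontI
    (fun i => xik _) uzs zsE Fd (Fa _) vuF FL0 FLi).
- exact: (@star_rip1 _ _ _ _ _ _ _ _ (fun=> eta2) _ _ (ltn0Sn k) (ltn0Sn 0) eps0 b0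
    (fun=> eta2_0) (fun=> eta2_1) xi0 xiI xib xik bk uzs zsE GL
    (fun=> uG) (fun=> vG) Gd Ga (fun=> vuG) uvG GL0 GLi).
- split.
    exact: (@star_local_data _ _ _ _ _ _ _ _ (fun=> eta2) _ _
      (fun=> eta2_0) (fun=> eta2_1) xiI uzs zsE GL
      (fun=> uG) (fun=> vG) Gd Ga (fun=> vuG) GL0 GLi _ one_mult).
  move=> L' L'G; exact: (@star_unique _ _ _ _ _ _ _ _ (fun=> eta2) _ _ (ltn0Sn k) (ltn0Sn 0) eps0 b0
    (fun=> eta2_0) (fun=> eta2_1) xi0 xiI xib xik bk uzs zsE GL
    (fun=> uG) (fun=> vG) Gd Ga (fun=> vuG) uvG GL0 GLi _ L' one_mult L'G).
(* The pull-back of [L] and [D] have the same matrices on generators, so the identity is an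
   isomorphism. *)
- apply: (@ls_iso_gens _ _ _ (ls_restrict (fat_incl n m.+1 s) L) D 1%:M 1%:M);
    rewrite ?mulmx1 // => x.
  rewrite mul1mx mulmx1 /= (lift_fun_gen (@fat_gen_rel n m.+1 s)).
  case: x => [i|||] /=; [|exact: L0|exact: Li|by rewrite Ld -Ddelta].
  rewrite (ord1 i) [RHS]Dalpha; apply: (etrans (ls_prod L _)).
  by apply: eq_bigr => j _; apply: La.
Qed.
End Main.
End Construction.

(* The sign of eta2 is the one forced by det rho(alpha_1) det rho(omega_oo) =
   det rho(omega_0) for the local system G. *)
Theorem theorem7p1 (R : realType) (n k l : nat) (r s : int)
    (eps b : complex R) (lambda : 'I_l -> complex R)
    (xi : 'I_k.+1 -> complex R) (eta1 eta2 : complex R)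
    (k_ge1 : (1 <= k)%N) (n_gt_k : (k < n)%N) (co_nk : coprime n k)
    (l_ge1 : (1 <= l)%N)
    (rs_nk : r * n%:Z = k%:Z * s + 1)
    (eps_neq0 : eps <> 0) (b_neq0 : b <> 0)
    (lambda_neq0 : forall i, lambda i <> 0)
    (xi_neq0 : forall i, xi i <> 0)
    (eta1_def : eta1 = (-1) ^+ (k - 1) * eps ^ r * \prod_(i < k) (front xi i)^-1)
    (eta2_def : eta2 =
       (-1) ^+ (k - 1) * eps ^ r * b * \prod_(i < k.+1) (xi i)^-1)
    (lambda_neq1 : forall i, lambda i <> 1)
    (eta1_neq1 : eta1 <> 1) (eta2_neq1 : eta2 <> 1)
    (lambda_neq_eta1 : forall i, lambda i <> eta1)
    (xi_distinct : forall i j, i <> j -> xi i <> xi j)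
    (xi_neq_b : forall i, xi i <> b)
    (xi_pow_k : forall i, xi i ^+ k <> eps ^ r)
    (b_pow_k : b ^+ k <> eps ^ r)
    (sum_xi_neq0 : \sum_(i < k) front xi i <> 0)
    (eta12 : eta1 <> eta2)
    (det_rel : (\prod_(i < l) lambda i) * (\prod_(i < k) front xi i ^+ l)
                 * xi ord_max
               = (-1) ^+ ((k - 1) * l) * b * eps ^ (r * l%:Z))
    (xi_pow_n : forall i, xi i ^+ n = eps ^ s) :
  exists L : local_system (complex R) (pi1_compl_star n l s),
    [/\ rip1_star k r L,
        local_data_star k r eps b lambda xi
          (fun j => if j == ord_max then 1%N else l) L
      & exists (F : local_system (complex R) (pi1_compl n k 1 r s))
               (G : local_system (complex R) (pi1_compl_star n 1 s)),
        [/\ rip1 F,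
            unique_up_to_iso
              (local_data eps (fun=> eta1) (front xi) (fun=> 1%N)) F,
            rip1_star k r G,
            unique_up_to_iso
              (local_data_star k r eps b (fun=> eta2) xi (fun=> 1%N)) G
          & ls_iso (ls_restrict (fat_incl n l s) L)
                   (dsum (dsum_pow (ls_restrict (fill_shaft n k 1 r s) F) (l - 1))
                         G)]].
Proof.
(* Writing k, and then l, as successors turns k - 1 and l - 1 into variables. *)
case: k k_ge1 n_gt_k co_nk rs_nk xi eta1_def eta2_def xi_neq0 xi_distinct xi_neq_b
  xi_pow_k b_pow_k sum_xi_neq0 det_rel xi_pow_n => // {}k _ _ _ _ {}xi.
rewrite !subSS !subn0 => eta1E eta2E xi0 xiI xib xik bk _ det_rel xin.
case: l l_ge1 lambda lambda_neq0 lambda_neq1 lambda_neq_eta1 det_rel => // m _ lam.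
move=> lam0 lam1 lam_eta1 det_rel.
have neqP (x y : complex R) : x <> y -> x != y by move/eqP.
have eps0 := neqP _ _ eps_neq0; have xi0' i := neqP _ _ (xi0 i).
have [zs uzs zsE] := separated_roots (ltn0Sn k) (expfz_neq0 r eps0).
rewrite subn1 /=; apply: (@main_existence _ n k m r s eps b lam xi eta1 eta2 zs) => //.
- exact: neqP.
- by move=> i; apply: neqP.
- by move=> i; apply: neqP.
- exact: neqP.
- exact: neqP.
- by move=> i; apply: neqP.
- by move=> i j xij; apply/eqP/negPn/negP => /eqP /xiI.
- by move=> i; apply: neqP.
- by move=> i; apply: neqP.
- exact: neqP.
- exact: neqP.
(* The product of the lambda_i is shown to be eta2 eta1^m: both sides are multiplied by the last xi
   and by the power m + 1 of the product of the others, which clears denominators. *)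
- have P0 : \prod_(i < k.+1) front xi i != 0 by apply/prodf_neq0 => i _; apply: xi0'.
  have w0 := xi0' ord_max.
  move: det_rel; rewrite prodrXl => det_rel.
  apply: (mulIf w0); apply: (mulIf (expf_neq0 m.+1 P0)); rewrite mulrAC det_rel.
  rewrite eta1E eta2E !prodfV [in RHS]big_ord_recr /=.
  rewrite -exprz_exp -exprnP exprM.
  set P := \prod_(i < k.+1) front xi i in P0 *.
  rewrite !exprMn exprVn !exprS; have Pm0 := expf_neq0 m P0.
  by field; rewrite P0 Pm0 w0.
Qed.
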